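(* Let $\kappa=2$. For every $\beta\in[0,\infty]$, every $\varepsilon>0$ and every $N\ge 1$, $$\mathbb{E}\,G_{N,\beta}\bigl(\{\sigma\in\Sigma_2:\ \|d(\sigma)-2^{-1}\mathbf{1}\|_\infty\ge\varepsilon\}\bigr)\le 2e^{-\varepsilon^2N}.$$ Consequently, the Potts spin glass model with $\kappa=2$ colors preserves color symmetry for all $\beta\in[0,\infty]$.
   Context: For an integer $N\ge1$ write $[N]=\{1,\dots,N\}$. Let $\Sigma_2=\{1,2\}^N$. For $\sigma\in\Sigma_2$ the magnetization vector is $d(\sigma)=(N^{-1}|\{i\in[N]:\sigma_i=a\}|)_{a\in\{1,2\}}\in\mathbb R^2$, $\mathbf 1=(1,1)$ is the all-ones vector, and $\|\cdot\|_\infty$ is the $\ell^\infty$-norm on $\mathbb R^2$. Let $(g_{ij})_{i,j\in[N]}$ be i.i.d. standard normal random variables. The Hamiltonian is $H_N(\sigma)=\frac{1}{\sqrt N}\sum_{i,j\in[N]}g_{ij}\mathbf 1\{\sigma_i=\sigma_j\}$. For $\beta\in[0,\infty)$ the Gibbs measure is the (random) probability measure $G_{N,\beta}$ on $\Sigma_2$ with $G_{N,\beta}(\sigma)=\exp(\beta H_N(\sigma))/\sum_{\sigma'\in\Sigma_2}\exp(\beta H_N(\sigma'))$; for $\beta=\infty$, $G_{N,\infty}$ is the uniform distribution on the set of configurations in $\Sigma_2$ maximizing $H_N$. $\mathbb E$ is expectation over $(g_{ij})$. The balanced configurations $\Sigma^{\mathrm{bal}}_2$ are those with $d(\sigma)=2^{-1}\mathbf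 1$ (whenever the balanced constraint is imposed, $N$ is assumed even). Put $F_{N,\beta}=\frac1N\mathbb E\log\sum_{\sigma\in\Sigma_2}e^{\beta H_N(\sigma)}$ and $\mathsf{GSE}_{N}=\frac1N\mathbb E\max_{\sigma\in\Sigma_2}H_N(\sigma)$, and let $F^{\mathrm{bal}}_{N,\beta}$, $\mathsf{GSE}^{\mathrm{bal}}_{N}$ be the same quantities with $\Sigma_2$ replaced by $\Sigma_2^{\mathrm{bal}}$. The model preserves color symmetry at $\beta\in[0,\infty)$ if $\lim_{N\to\infty}F^{\mathrm{bal}}_{N,\beta}=\lim_{N\to\infty}F_{N,\beta}$, and at $\beta=\infty$ if $\lim_{N\to\infty}\mathsf{GSE}^{\mathrm{bal}}_{N}=\lim_{N\to\infty}\mathsf{GSE}_{N}$ (limits of balanced quantities along even $N$; all these limits are known to exist). *)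

(* Defs.v *)
From mathcomp Require Import all_boot all_order all_algebra.
From mathcomp Require Import all_classical all_reals all_analysis.
Import Order.TTheory GRing.Theory Num.Theory.
Import numFieldNormedType.Exports.

Set Implicit Arguments.
Unset Strict Implicit.
Unset Printing Implicit Defensive.

Local Open Scope ring_scope.

(* The two colors 1, 2 are the two elements of 'I_2; the sites are 'I_N. *)
Notation config N := {ffun 'I_N -> 'I_2}.

Section Deterministic.
Context {R : realType} {N : nat}.
Implicit Types (g : 'I_N -> 'I_N -> R) (s : config N) (A : {set config N}).

Definition magnetization s : 'rV[R]_2 :=
  \row_a ((N%:R)^-1 * #|[set i | s i == a]%SET|%:R).

(* The norm of 'rV[R]_2 is mx_norm, the sup norm. *)
Definition unbalanced (eps : R) : {set config N} :=
  [set s | eps <= `|magnetization s - 2^-1 *: const_mx 1|]%SET.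

Definition balanced : {set config N} :=
  [set s | magnetization s == 2^-1 *: const_mx 1]%SET.

Definition hamiltonian g s : R :=
  (Num.sqrt N%:R)^-1 * \sum_i \sum_j g i j * (s i == s j)%:R.

Definition partition_function (b : R) g A : R :=
  \sum_(s in A) expR (b * hamiltonian g s).

Definition maximizers g : {set config N} :=
  [set s | [forall s', hamiltonian g s' <= hamiltonian g s]]%SET.

(* The maximum over a finite set, as a supremum; it is only used for nonempty
   sets (the balanced configurations being taken for even N only). *)
Definition max_hamiltonian g A : R :=
  sup [set hamiltonian g s | s in [set` A]]%classic.

(* Point masses; only beta in [0, +oo] is meaningful. *)
Definition gibbs_mass (beta : \bar R) g s : R :=
  match beta with
  | b%:E%E => expR (b * hamiltonian g s) / partition_function b g [set: config N]
  | +oo%E => (s \in maximizers g)%:R / #|maximizers g|%:R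
  | -oo%E => 0
  end.

Definition gibbs (beta : \bar R) g A : R := \sum_(s in A) gibbs_mass beta g s.

End Deterministic.

Section Disorder.
Context {R : realType} {d : measure_display} {T : measurableType d}.
Variable P : probability T R.

Definition mutually_independent (I : finType) (X : I -> {RV P >-> R}) : Prop :=
  forall (J : {set I}) (B : I -> set R), (forall i, measurable (B i)) ->
    P [set w | forall i, i \in J -> B i (X i w)]%classic =
    (\prod_(i in J) P (X i @^-1` B i)%classic)%E.

Definition standard_normal (X : {RV P >-> R}) : Prop :=
  forall B : set R, measurable B -> distribution P X B = normal_prob 0 1 B.

Definition iid_standard_normal (N : nat) (g : 'I_N -> 'I_N -> {RV P >-> R}) :=
  (forall i j, standard_normal (g i j)) /\
  mutually_independent (fun ij : 'I_N * 'I_N => g ij.1 ij.2).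

Variables (N : nat) (g : 'I_N -> 'I_N -> {RV P >-> R}).

Definition couplings (w : T) : 'I_N -> 'I_N -> R := fun i j => g i j w.

Definition mean_gibbs (beta : \bar R) (A : {set config N}) : \bar R :=
  'E_P[fun w => gibbs beta (couplings w) A]%E.

Definition free_energy (b : R) (A : {set config N}) : R :=
  (N%:R)^-1 * fine 'E_P[fun w => ln (partition_function b (couplings w) A)]%E.

Definition ground_state_energy (A : {set config N}) : R :=
  (N%:R)^-1 * fine 'E_P[fun w => max_hamiltonian (couplings w) A]%E.

End Disorder.

(* The disorder at different sizes N may live on different probability spaces:
   only its law at each fixed N matters.  The balanced quantities are taken
   along the even sizes k.*2.  The limits are known to exist; limn is the total
   limit operator of the library. *)
Definition preserves_color_symmetry {R : realType} {d : nat -> measure_display}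
    {T : forall N, measurableType (d N)} {P : forall N, probability (T N) R}
    (g : forall N, 'I_N -> 'I_N -> {RV (P N) >-> R}) (beta : \bar R) : Prop :=
  match beta with
  | b%:E%E =>
      limn (fun k : nat => free_energy (g k.*2) b (@balanced R k.*2)) =
      limn (fun N : nat => free_energy (g N) b [set: config N])
  | +oo%E =>
      limn (fun k : nat => ground_state_energy (g k.*2) (@balanced R k.*2)) =
      limn (fun N : nat => ground_state_energy (g N) [set: config N])
  | -oo%E => False
  end.

(* Main.v *)
From HB Require Import structures.
Require Import Defs.
From mathcomp Require Import all_boot all_order all_algebra.
From mathcomp Require Import all_classical all_reals all_analysis.
From mathcomp Require Import measurable_realfun.
From mathcomp Require Import ring lra zify.
Import Order.TTheory GRing.Theory Num.Theory.
Import numFieldNormedType.Exports.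
Set Implicit Arguments.
Unset Strict Implicit.
Unset Printing Implicit Defensive.
Local Open Scope classical_set_scope.
Local Open Scope ring_scope.

(** With two colors, the indicator of [s i = s j] is affine in the product of the
two spins, so the Hamiltonian has a gauge symmetry: translating a configuration
by [eta], that is exchanging the two colors at the sites where [eta] is
nonzero, amounts, up to a term that does not depend on the configuration, to
changing the sign of [g i j] whenever [eta i != eta j]
([hamiltonian_gauge]).  The constant cancels in the Gibbs measure and the law of
the couplings is invariant under the sign changes ([gaussian_flip]), so the mean
Gibbs measure is invariant under all translations of the hypercube: it is the
uniform measure ([expectation_gibbs_mass]), at every temperature and at
temperature zero.  The bound is then Hoeffding's inequality for N independent
fair coins ([card_unbalanced]).

For the symmetry, write F and B for the free energies (or ground state energies)
without and with the balance constraint.  What is proved is that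
[F (2k) - B k] and [F (N+1) - F N] tend to 0.  It follows that either limit
exists as soon as the other does, and that they are then equal
([limn_even_eq]).

For the first difference, let M be a little larger than the square root of N.
With overwhelming probability more than half of the Gibbs measure sits on
configurations at most M flips away from balance: the mean mass of the
complement is at most [2 exp (- M^2 / N)].  Such configurations are balanced one
flip at a time.  Averaging over the majority color, the energy lost by a flip is
at most [2 N^(-3/2)] times the sum of two bilinear forms in the couplings and a
diagonal term, so some flip is that cheap ([exists_cheap_flip]); a bilinear form with coefficients
in [-1, 1] is controlled by a fourth moment of the coupling matrix
([bilinear_form4_le]), whose mean is small because products of distinct
couplings are orthogonal ([expectation_gram]).  One flip therefore costs about
[N^(1/4)] in energy, and the factor [N + 1] in multiplicity costs [ln (N + 1)].
The choice of M near [N^(2/3)] makes the total cost [O(N^(11/12))], while the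
exceptional event, paid at the crude price of the second moment of the energy,
contributes no more ([mean_pressure_gap_asymptotics]).

For the second difference, the couplings among the first N of N + 1 sites are a
field of size N, and the remaining 2N + 1 couplings change the energy by
[O(sqrt N)] in mean ([mean_pressureS_le]).

Finite beta and beta infinite are treated at once: the logarithm of the
partition function and the maximum of the energy both obey the comparison
principle [pressure_le_map]. *)

(** * Gaussian fields and the invariance of their law *)

Section Law.
Variables (R : realType) (I : finType).

(** Couplings are regarded as a random point of [I -> R], with the sigma-algebra
generated by the boxes; these are stable under intersection, so a law is
determined by its values on them. *)
Definition box (B : I -> set R) : set (I -> R) := [set x | forall i, B i (x i)].

Definition boxes : set (set (I -> R)) :=
  [set A | exists2 B, forall i, measurable (B i) & A = box B].

Lemma boxes_setI : setI_closed boxes.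
Proof.
move=> _ _ [B mB ->] [C mC ->]; exists (fun i => B i `&` C i).
  by move=> i; exact: measurableI.
apply/seteqP; split => [x [Bx Cx] i|x BCx]; first by split.
by split => i; case: (BCx i).
Qed.
End Law.

Notation field_space R I := (g_sigma_algebraType (@boxes R I)).

Section Field.
Context {R : realType} {I : finType}.

Lemma measurable_box (d : measure_display) (T : measurableType d)
    (f : T -> I -> R) (B : I -> set R) :
    (forall i, measurable_fun setT (fun w => f w i)) ->
    (forall i, measurable (B i)) -> measurable (f @^-1` box B).
Proof.
move=> mf mB.
rewrite [X in measurable X](_ : _ = \bigcap_(i in [set: I]) [set w | B i (f w i)]).
  apply: fin_bigcap_measurable => // i _; rewrite -[X in measurable X]setTI.
  exact: mf.
by apply/seteqP; split => w Bw i; [move=> _; exact: Bw|exact: Bw].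
Qed.

Lemma measurable_field (d : measure_display) (T : measurableType d)
    (f : T -> field_space R I) :
  (forall i, measurable_fun setT (fun w => f w i)) -> measurable_fun setT f.
Proof.
move=> mf; apply: (@measurability _ _ T (field_space R I) setT f (@boxes R I)) => //
  _ [_ [B mB ->] <-].
by rewrite setTI; exact: measurable_box.
Qed.

Lemma measurable_coord (i : I) :
  measurable_fun setT (fun x : field_space R I => x i).
Proof.
move=> _ B mB; apply: sub_sigma_algebra; rewrite setTI.
exists (fun j => if j == i then B else setT).
  by move=> j; case: ifP.
apply/seteqP; split => [x Bx j /=|x /(_ i)]; last by rewrite eqxx.
by case: eqP => // ->.
Qed.

(** The product rule for the full family of coordinates, which is independence
since the factors may be the whole line. *)
Definition gaussian_field (mu : probability (field_space R I) R) : Prop :=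
  forall B : I -> set R, (forall i, measurable (B i)) ->
    mu (box B) = (\prod_i normal_prob 0 1 (B i))%E.

Lemma gaussian_field_unique (mu nu : probability (field_space R I) R) :
  gaussian_field mu -> gaussian_field nu ->
  forall A, measurable A -> mu A = nu A.
Proof.
move=> gmu gnu A mA.
apply: (@measure_unique _ R (field_space R I) (@boxes R I) (fun _ => setT)) => //.
- exact: boxes_setI.
- by move=> _; exists (fun _ => setT) => //; apply/seteqP; split.
- by rewrite bigcup_const.
- by move=> _ [B mB ->]; exact: (etrans (gmu _ mB) (esym (gnu _ mB))).
- by move=> k; apply: (le_lt_trans (@probability_le1 _ _ _ mu _ _)); rewrite ?ltry.
Qed.

End Field.

Lemma normal_probN {R : realType} (B : set R) : measurable B ->
  normal_prob 0 1 (-%R @^-1` B) = normal_prob 0 1 B :> \bar R.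
Proof.
move=> mB; rewrite /normal_prob.
have mf : measurable_fun [set: R] (EFin \o @normal_pdf R 0 1).
  by apply/measurable_EFinP; exact: measurable_normal_pdf.
transitivity (\int[pushforward lebesgue_measure (-%R : _ -> measurableTypeR R)]_(x in B)
   (@normal_pdf R 0 1 x)%:E)%E; last first.
  by apply: eq_measure_integral => A mA _; exact: lebesgue_measureN.
rewrite ge0_integral_pushforward//=; last 2 first.
- exact: measurable_funTS.
- by move=> x _; rewrite lee_fin normal_pdf_ge0.
apply: eq_integral => x _; congr EFin.
by rewrite /= !normal_pdfE ?oner_neq0// /normal_fun !subr0 sqrrN.
Qed.

(** The positive parts have the same integral on both sides, and so do the
negative parts, be these integrals finite or not. *)
Lemma integral_pushforward_measurable {R : realType} (d1 d2 : measure_display)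
    (T1 : measurableType d1) (T2 : measurableType d2) (h : {mfun T1 >-> T2})
    (m : {measure set T1 -> \bar R}) (f : T2 -> \bar R) :
  measurable_fun setT f ->
  (\int[pushforward m h]_x f x = \int[m]_x f (h x))%E.
Proof.
move=> mf; rewrite [LHS]integralE [RHS]integralE.
have mp : measurable_fun setT f^\+%E by exact: measurable_funepos.
have mn : measurable_fun setT f^\-%E by exact: measurable_funeneg.
have push (k : T2 -> \bar R) : measurable_fun setT k -> (forall x, 0 <= k x)%E ->
    (\int[pushforward m h]_x k x = \int[m]_x k (h x))%E.
  by move=> mk k0; rewrite ge0_integral_pushforward.
rewrite (push _ mp)// (push _ mn)//.
congr (_ - _)%E; apply: eq_integral => x _.
  by rewrite funeposE [RHS]funeposE.
by rewrite funenegE [RHS]funenegE.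
Qed.

(** A map [h] that carries a field to one with the Gaussian box probabilities
transports integrals, by uniqueness of the Gaussian field. *)
Section Pushforward.
Context {R : realType} {I J : finType}.
Variables (mu : probability (field_space R I) R) (nu : probability (field_space R J) R).
Hypothesis gnu : gaussian_field nu.
Variable h : (I -> R) -> J -> R.
Hypothesis mh : forall j, measurable_fun setT (fun x : field_space R I => h x j).
Hypothesis h_box : forall B, (forall j, measurable (B j)) ->
  mu (h @^-1` box B) = (\prod_j normal_prob 0 1 (B j))%E.

Let h' : field_space R I -> field_space R J := h.
Let mh' : measurable_fun setT h'. Proof. exact: measurable_field. Qed.
HB.instance Definition _ := isMeasurableFun.Build _ _ _ _ h' mh'.

Lemma gaussian_transfer A : measurable A -> pushforward mu h' A = nu A.
Proof.
by move=> mA; apply: (@gaussian_field_unique _ _ (distribution mu h') nu).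
Qed.

Lemma integral_gaussian (f : field_space R J -> \bar R) :
  measurable_fun setT f -> (\int[mu]_x f (h x) = \int[nu]_x f x)%E.
Proof.
move=> mf; transitivity (\int[pushforward mu h']_x f x)%E.
  by rewrite integral_pushforward_measurable.
by apply: eq_measure_integral => A mA _; exact: gaussian_transfer.
Qed.

End Pushforward.

Section Invariance.
Context {R : realType}.

(** Each coordinate is symmetric, hence changing the sign of an arbitrary set of
coordinates fixes the box probabilities. *)
Lemma gaussian_flip (I : finType) (mu : probability (field_space R I) R)
    (e : I -> bool) (f : field_space R I -> \bar R) :
  gaussian_field mu -> measurable_fun setT f ->
  (\int[mu]_x f (fun i => (-1) ^+ e i * x i)%R = \int[mu]_x f x)%E.
Proof.
move=> gmu mf; apply: (@integral_gaussian _ _ _ mu mu gmu (fun x i => (-1) ^+ e i * x i)) => //.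
  move=> i; apply: measurable_funM => //; exact: measurable_coord.
move=> B mB.
rewrite [X in mu X](_ : _ = box (fun i => if e i then -%R @^-1` B i else B i)).
  rewrite gmu.
    by apply: eq_bigr => i _; case: ifP => // _; rewrite normal_probN.
  move=> i; case: ifP => // _; rewrite -[X in measurable X]setTI.
  by apply: oppr_measurable.
apply/seteqP; split => x Bx i /=; move: (Bx i) => /=.
  by case: (e i); rewrite /= ?expr0 ?expr1 ?mul1r ?mulN1r.
by case: (e i); rewrite /= ?expr0 ?expr1 ?mul1r ?mulN1r.
Qed.

Lemma prode_restrict (I J : finType) (q : J -> I) (F : J -> \bar R)
  (G : I -> \bar R) : injective q -> (forall j, G (q j) = F j) ->
  (forall i, i \notin codom q -> G i = 1%E) ->
  (\prod_i G i = \prod_j F j)%E.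
Proof.
move=> qi GF G1; rewrite (bigID (fun i => i \in codom q)) /=.
rewrite [X in (_ * X)%E]big1// mule1.
rewrite (eq_bigl (fun i => i \in q @: [set: J])%SET); last first.
  move=> i; apply/codomP/imsetP => [[j ->]|[j _ ->]]; exists j => //.
rewrite big_imset /=; last by move=> j k _ _ /qi.
by apply: eq_big => [j|j _]; rewrite ?inE ?GF.
Qed.

(** Forgetting coordinates amounts to boxes whose forgotten sides are the whole
line, of probability 1. *)
Lemma gaussian_subfield (I J : finType) (mu : probability (field_space R I) R)
    (nu : probability (field_space R J) R) (q : J -> I)
    (f : field_space R J -> \bar R) :
  gaussian_field mu -> gaussian_field nu -> injective q ->
  measurable_fun setT f ->
  (\int[mu]_x f (x \o q) = \int[nu]_x f x)%E.
Proof.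
move=> gmu gnu qi mf; apply: (@integral_gaussian _ _ _ mu nu gnu (fun x => x \o q)) => //.
  by move=> j; exact: measurable_coord.
move=> B mB.
pose C i := if [pick j | q j == i] is Some j then B j else setT.
have CB j : C (q j) = B j.
  rewrite /C; case: pickP => [k /eqP/qi ->//|/(_ j)]; by rewrite eqxx.
rewrite [X in mu X](_ : _ = box C); last first.
  apply/seteqP; split => x Bx; last by move=> j /=; rewrite -CB.
  by move=> i; rewrite /C; case: pickP => // j /eqP <-; exact: Bx.
rewrite gmu; last by move=> i; rewrite /C; case: pickP.
apply: prode_restrict qi _ _ => [j|i iq]; first by rewrite CB.
rewrite /C; case: pickP => [j /eqP ji|_]; last exact: probability_setT.
by case/negP: iq; apply/codomP; exists j.
Qed.

End Invariance.

Section Law.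
Context {R : realType}.

(** All statements about the given probability space become statements about
the law of the couplings. *)
Lemma iid_gaussian_field (d : measure_display) (T : measurableType d)
    (P : probability T R) (N : nat) (g : 'I_N -> 'I_N -> {RV P >-> R}) :
  iid_standard_normal g ->
  exists2 mu : probability (field_space R ('I_N * 'I_N)%type) R, gaussian_field mu &
    forall f : field_space R ('I_N * 'I_N)%type -> \bar R, measurable_fun setT f ->
    (\int[P]_w f (fun ij => g ij.1 ij.2 w) = \int[mu]_x f x)%E.
Proof.
case=> std ind.
pose h : T -> field_space R ('I_N * 'I_N)%type := fun w ij => g ij.1 ij.2 w.
have mh : measurable_fun setT h.
  by apply: measurable_field => ij; exact: measurable_funP.
pose H := isMeasurableFun.Build _ _ _ _ h mh.
pose h' : {mfun T >-> field_space R ('I_N * 'I_N)%type} := HB.pack h H.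
exists (distribution P h').
  move=> B mB; rewrite /distribution /pushforward.
  have := ind [set: 'I_N * 'I_N]%SET B mB.
  rewrite [X in P X](_ : _ = h' @^-1` box B); last first.
    apply/seteqP; split => w Bw ij; first by apply: Bw; rewrite finset.in_setT.
    by move=> _; exact: Bw.
  move=> indB; apply: (etrans indB); apply: eq_big => [ij|ij _]; first by rewrite finset.in_setT.
  exact: std.
by move=> f mf; rewrite -(integral_pushforward_measurable h').
Qed.

Lemma gaussian_coord (I : finType) (mu : probability (field_space R I) R) (i : I)
    (f : measurableTypeR R -> \bar R) : gaussian_field mu -> measurable_fun setT f ->
  (\int[mu]_x f (x i) = \int[normal_prob 0 1]_y f y)%E.
Proof.
move=> gmu mf.
pose h : field_space R I -> measurableTypeR R := fun x => x i.
have mh : measurable_fun setT h by exact: measurable_coord.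
pose H := isMeasurableFun.Build _ _ _ _ h mh.
pose h' : {mfun field_space R I >-> measurableTypeR R} := HB.pack h H.
transitivity (\int[pushforward mu h']_y f y)%E.
  by rewrite integral_pushforward_measurable.
apply: eq_measure_integral => A mA _.
pose B j := if j == i then A : set R else setT.
have mB j : measurable (B j) by rewrite /B; case: ifP.
transitivity (mu (box B)).
  congr (mu _); apply/seteqP; split => x /=; rewrite /h /box /B /=.
    by move=> xA j; case: eqP => //= ->.
  by move=> /(_ i); rewrite eqxx.
rewrite gmu// (bigD1 i)//= big1 ?mule1.
  by rewrite /B eqxx.
by move=> j /negbTE ji; rewrite /B ji; exact: probability_setT.
Qed.

End Law.

(** * Moments of a Gaussian field *)

Section NormalMoments.
Context {R : realType}.
Local Notation leb := (@lebesgue_measure R).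

(** The Radon-Nikodym derivative of the normal law is almost everywhere its
density, because both have the same integral on every Borel set. *)
Lemma ge0_integral_normal_prob (f : R -> \bar R) :
  measurable_fun setT f -> (forall x, 0 <= f x)%E ->
  (\int[normal_prob 0 1]_x f x = \int[leb]_x (f x * (normal_pdf 0 1 x)%:E))%E.
Proof.
move=> mf f0; have dom := @normal_prob_dominates R 0 1.
rewrite -(Radon_Nikodym_SigmaFinite.change_of_variables dom)//.
have mRN := measurable_int _ (Radon_Nikodym_SigmaFinite.f_integrable dom).
have mpdf : measurable_fun [set: R] (fun x => (normal_pdf 0 1 x)%:E : \bar R).
  by apply/measurable_EFinP; exact: measurable_normal_pdf.
apply: ae_eq_integral => //.
- exact: emeasurable_funM.
- exact: emeasurable_funM.
- apply: ae_eqe_mul2l; apply: integral_ae_eq => //.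
  + exact: Radon_Nikodym_SigmaFinite.f_integrable.
  + by move=> E _ mE; rewrite -Radon_Nikodym_SigmaFinite.f_integral.
Qed.

(** The product of [x ^+ 4] and the standard density is dominated by a multiple
of the density of variance 4, a probability density. *)
Lemma normal_fourth_moment_lty :
  (\int[normal_prob 0 1]_x ((x : R) ^+ 4)%:E < +oo)%E.
Proof.
have m4 : measurable_fun [set: R] (fun x : R => x ^+ 4).
  exact: exprn_measurable.
rewrite ge0_integral_normal_prob; last 2 first.
- exact/measurable_EFinP.
- by move=> x; rewrite lee_fin exprn_even_ge0.
pose C : R := 16 * normal_peak 1 / normal_peak 2.
have p1 : 0 < normal_peak 1 :> R by apply: normal_peak_gt0; rewrite oner_eq0.
have p2 : 0 < normal_peak 2 :> R by apply: normal_peak_gt0; rewrite pnatr_eq0.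
have C0 : 0 <= C by rewrite /C divr_ge0 ?mulr_ge0// ltW.
apply: (@le_lt_trans _ _ (\int[leb]_x (C%:E * (normal_pdf 0 2 x)%:E))%E).
  apply: ge0_le_integral => //.
  - move=> x _; rewrite -EFinM lee_fin mulr_ge0 ?normal_pdf_ge0//.
    by rewrite exprn_even_ge0.
  - apply/measurable_EFinP; apply: measurable_funM => //.
    exact: measurable_normal_pdf.
  - apply/measurable_EFinP; apply: measurable_funM => //.
    exact: measurable_normal_pdf.
  - move=> x _; rewrite -!EFinM lee_fin !normal_pdfE ?oner_eq0 ?pnatr_eq0//.
    rewrite /C /normal_fun subr0.
    rewrite mulrA [X in _ <= X](_ : _ =
      16 * normal_peak 1 * expR (- x ^+ 2 / (2 ^+ 2 *+ 2))); last first.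
      by rewrite -!mulrA mulKf ?gt_eqF.
    have -> : - x ^+ 2 / (1 ^+ 2 *+ 2) = - x ^+ 2 / (2 ^+ 2 *+ 2) + - (3 / 8 * x ^+ 2).
      by field.
    rewrite expRD; set E1 := expR _; set E2 := expR _.
    have -> : x ^+ 4 * normal_peak 1 * (E1 * E2) =
        normal_peak 1 * E1 * (x ^+ 4 * E2) by ring.
    have -> : 16 * normal_peak 1 * E1 = normal_peak 1 * E1 * 16 by ring.
    apply: ler_wpM2l; first by rewrite mulr_ge0 ?expR_ge0// ltW.
    rewrite /E2 expRN ler_pdivrMr ?expR_gt0//.
    have x2 : 0 <= x ^+ 2 by rewrite sqr_ge0.
    (* [16 * exp u >= 8 * u ^+ 2 >= x ^+ 4] for [u = 3/8 x ^+ 2]. *)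
    have u0 : 0 <= 3 / 8 * x ^+ 2 by rewrite mulr_ge0.
    have := expR_ge1Dxn 1 u0; rewrite (_ : (2`!)%:R = 2 :> R)//.
    have -> : x ^+ 4 = (x ^+ 2) ^+ 2 by rewrite -exprM.
    set E := expR _; nra.
rewrite ge0_integralZl//.
- by rewrite integral_normal_pdf mule1 ltry.
- by apply/measurable_EFinP; exact: measurable_normal_pdf.
- by move=> x _; rewrite lee_fin normal_pdf_ge0.
Qed.

End NormalMoments.

Section RintegralSum.
Context {R : realType} {d : measure_display} {T : measurableType d}
  (mu : {measure set T -> \bar R}).

Lemma integrable_addR (f g : T -> R) :
  mu.-integrable setT (EFin \o f) -> mu.-integrable setT (EFin \o g) ->
  mu.-integrable setT (EFin \o (fun x => f x + g x)).
Proof.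
move=> fi gi; apply: (eq_integrable measurableT ((EFin \o f) \+ (EFin \o g))%E) => //.
exact: integrableD.
Qed.

Lemma integrable_mulR (c : R) (f : T -> R) :
  mu.-integrable setT (EFin \o f) ->
  mu.-integrable setT (EFin \o (fun x => c * f x)).
Proof.
move=> fi; apply: (eq_integrable measurableT (fun x => c%:E * (EFin \o f) x)%E) => //.
exact: integrableZl.
Qed.

Lemma integrable_sumR (I : Type) (r : seq I) (P : pred I) (f : I -> T -> R) :
  (forall i, P i -> mu.-integrable setT (EFin \o f i)) ->
  mu.-integrable setT (EFin \o (fun x => \sum_(i <- r | P i) f i x)).
Proof.
move=> fi.
apply: (eq_integrable measurableT (fun x => \sum_(i <- r | P i) (f i x)%:E)%E) => //.
  by move=> x _; rewrite sumEFin.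
exact: integrable_sum.
Qed.

Lemma Rintegral_sum (I : Type) (r : seq I) (P : pred I) (f : I -> T -> R) :
  (forall i, P i -> mu.-integrable setT (EFin \o f i)) ->
  \int[mu]_x (\sum_(i <- r | P i) f i x) = \sum_(i <- r | P i) \int[mu]_x f i x.
Proof.
move=> fi; elim: r => [|i r IH].
  rewrite big_nil -[RHS](mul0r (fine (mu setT))) -Rintegral_cst//.
  by apply: eq_Rintegral => x _; rewrite big_nil.
rewrite big_cons -IH; case: ifPn => Pi.
  rewrite -RintegralD//; [|exact: fi|exact: integrable_sumR].
  by apply: eq_Rintegral => x _; rewrite big_cons Pi.
by apply: eq_Rintegral => x _; rewrite big_cons (negbTE Pi).
Qed.

End RintegralSum.

Section Moments.
Context {R : realType} {I : finType} (mu : probability (field_space R I) R).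
Hypothesis gmu : gaussian_field mu.
Implicit Types f : field_space R I -> R.

Definition fourth_moment : R := fine (\int[normal_prob 0 1]_x ((x : R) ^+ 4)%:E)%E.

Lemma fourth_moment_ge0 : 0 <= fourth_moment.
Proof.
by apply: fine_ge0; apply: integral_ge0 => x _; rewrite lee_fin exprn_even_ge0.
Qed.

Lemma integrable_coord4 i : mu.-integrable setT (EFin \o (fun x => x i ^+ 4)).
Proof.
apply/integrableP; split.
  by apply/measurable_EFinP; apply: measurable_funX; exact: measurable_coord.
under eq_integral do rewrite /= ger0_norm ?exprn_even_ge0//.
rewrite (gaussian_coord i (f := fun y => (y ^+ 4)%:E))//.
  exact: normal_fourth_moment_lty.
by apply/measurable_EFinP; exact: exprn_measurable.
Qed.

Lemma expectation_coord4 i : \int[mu]_x (x i ^+ 4) = fourth_moment.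
Proof.
rewrite /Rintegral (gaussian_coord i (f := fun y => (y ^+ 4)%:E))//.
by apply/measurable_EFinP; exact: exprn_measurable.
Qed.

(** An integrable envelope: every functional of the couplings integrated below
is either bounded or dominated through it. *)
Definition quartic (x : field_space R I) : R := 1 + \sum_i x i ^+ 4.

Lemma integrable_quartic : mu.-integrable setT (EFin \o quartic).
Proof.
apply: integrable_addR.
  exact: finite_measure_integrable_cst.
by apply: integrable_sumR => i _; exact: integrable_coord4.
Qed.

Lemma integrable_le_quartic C f : measurable_fun setT f ->
  (forall x, `|f x| <= C * quartic x) -> mu.-integrable setT (EFin \o f).
Proof.
move=> mf fC.
apply: (le_integrable measurableT _ (g := EFin \o (fun x => C * quartic x))).
- exact/measurable_EFinP.
- by move=> x _ /=; rewrite lee_fin (le_trans (fC x))// ler_norm.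
- exact: integrable_mulR integrable_quartic.
Qed.

Lemma le_quartic_coord (x : field_space R I) i : 1 + x i ^+ 4 <= quartic x.
Proof.
rewrite /quartic lerD2l (bigD1 i)//= lerDl sumr_ge0// => j _.
by rewrite exprn_even_ge0.
Qed.

Lemma quartic_ge1 (x : field_space R I) : 1 <= quartic x.
Proof.
by rewrite /quartic lerDl sumr_ge0// => j _; rewrite exprn_even_ge0.
Qed.

End Moments.

Lemma norm_le_quartic {R : realType} (y : R) : `|y| <= 1 + y ^+ 4.
Proof.
have -> : y ^+ 4 = (y ^+ 2) ^+ 2 by rewrite -exprM.
have -> : y ^+ 2 = `|y| ^+ 2 by rewrite real_normK ?num_real.
set t := `|y|; have := sqr_ge0 (t - 1); have := sqr_ge0 (t ^+ 2 - 1).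
by nra.
Qed.

Lemma sqr_le_quartic {R : realType} (y : R) : y ^+ 2 <= 1 + y ^+ 4.
Proof.
have -> : y ^+ 4 = (y ^+ 2) ^+ 2 by rewrite -exprM.
by have := sqr_ge0 (y ^+ 2 - 1); nra.
Qed.

Lemma norm_mul4_le {R : realType} (a b c e : R) :
  `|a * b * (c * e)| <= (a ^+ 4 + b ^+ 4 + c ^+ 4 + e ^+ 4) / 4.
Proof.
have e4 (y : R) : y ^+ 4 = (y ^+ 2) ^+ 2 by rewrite -exprM.
have h (u v : R) : `|u * v| <= (u ^+ 2 + v ^+ 2) / 2.
  have := sqr_ge0 (u - v); have := sqr_ge0 (u + v).
  by rewrite ler_norml => ? ?; apply/andP; split; nra.
apply: (le_trans (h _ _)); rewrite !exprMn !e4.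
have := h (a ^+ 2) (b ^+ 2); have := h (c ^+ 2) (e ^+ 2).
have := ler_norm (a ^+ 2 * b ^+ 2); have := ler_norm (c ^+ 2 * e ^+ 2).
lra.
Qed.

Lemma sqr_sum_le {R : realType} (J : finType) (a : J -> R) :
  (\sum_j a j) ^+ 2 <= #|J|%:R * \sum_j a j ^+ 2.
Proof.
set S := \sum_j a j ^+ 2; rewrite expr2 big_distrlr /=.
have row i : \sum_j (a i ^+ 2 + a j ^+ 2) / 2 = (#|J|%:R * a i ^+ 2 + S) / 2.
  by rewrite -mulr_suml big_split /= sumr_const mulr_natl.
apply: (@le_trans _ _ (\sum_i (#|J|%:R * a i ^+ 2 + S) / 2)).
  apply: ler_sum => i _; rewrite -row; apply: ler_sum => j _.
  by have := sqr_ge0 (a i - a j); nra.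
by rewrite -mulr_suml big_split /= sumr_const -mulr_sumr -/S -mulr_natl; lra.
Qed.

Lemma sum_eq_natr {R : realType} (J : finType) (i : J) :
  \sum_j (i == j)%:R = 1 :> R.
Proof.
by rewrite (bigD1 i)//= eqxx big1 ?addr0// => j; rewrite eq_sym => /negbTE ->.
Qed.

Section Gram.
Context {R : realType} {N : nat}.
Local Notation pairs := ('I_N * 'I_N)%type.
Variable mu : probability (field_space R pairs) R.
Hypothesis gmu : gaussian_field mu.

(** The squared Hilbert-Schmidt norm of [G G^T] for the matrix [G] with entries
[x (i, j)], which is the trace of [(G G^T)^2]. *)
Definition gram (x : field_space R pairs) : R :=
  \sum_i \sum_k (\sum_j x (i, j) * x (k, j)) ^+ 2.

Lemma gram_ge0 (x : field_space R pairs) : 0 <= gram x.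
Proof. by apply: sumr_ge0 => i _; apply: sumr_ge0 => k _; exact: sqr_ge0. Qed.

Let term (i k j l : 'I_N) (x : field_space R pairs) : R :=
  x (i, j) * x (k, j) * (x (i, l) * x (k, l)).

Lemma gramE x : gram x = \sum_i \sum_k \sum_j \sum_l term i k j l x.
Proof.
by apply: eq_bigr => i _; apply: eq_bigr => k _; rewrite expr2 big_distrlr.
Qed.

Lemma measurable_term i k j l : measurable_fun setT (term i k j l).
Proof.
by apply: measurable_funM; apply: measurable_funM; exact: measurable_coord.
Qed.

Lemma term_le i k j l x : `|term i k j l x| <=
  (x (i, j) ^+ 4 + x (k, j) ^+ 4 + x (i, l) ^+ 4 + x (k, l) ^+ 4) / 4.
Proof. exact: norm_mul4_le. Qed.

Lemma integrable_term i k j l : mu.-integrable setT (EFin \o term i k j l).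
Proof.
apply: (integrable_le_quartic gmu (C := 1)); first exact: measurable_term.
move=> x; rewrite mul1r; apply: (le_trans (term_le _ _ _ _ _)).
have := le_quartic_coord x (i, j); have := le_quartic_coord x (k, j).
have := le_quartic_coord x (i, l); have := le_quartic_coord x (k, l).
lra.
Qed.

Lemma integrable_gram : mu.-integrable setT (EFin \o gram).
Proof.
rewrite (_ : gram = fun x => \sum_i \sum_k \sum_j \sum_l term i k j l x); last first.
  by apply/funext => x; exact: gramE.
do 4 (apply: integrable_sumR => ? _); exact: integrable_term.
Qed.

Lemma expectation_term_le i k j l : \int[mu]_x term i k j l x <= fourth_moment.
Proof.
pose s := [:: (i, j); (k, j); (i, l); (k, l)].
have si : mu.-integrable setT (EFin \o (fun x => 4^-1 * \sum_(p <- s) x p ^+ 4)).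
  by apply/integrable_mulR/integrable_sumR => p _; exact: integrable_coord4.
apply: (@le_trans _ _ (\int[mu]_x (4^-1 * \sum_(p <- s) x p ^+ 4))).
  apply: le_Rintegral => //; first exact: integrable_term.
  move=> x _; apply: le_trans (ler_norm _) _; apply: le_trans (term_le _ _ _ _ _) _.
  by rewrite /s !big_cons big_nil; lra.
rewrite RintegralZl//; last by apply: integrable_sumR => p _; exact: integrable_coord4.
rewrite Rintegral_sum; last by move=> p _; exact: integrable_coord4.
under eq_bigr do rewrite expectation_coord4//.
by rewrite /s !big_cons big_nil; lra.
Qed.

(** The coupling [(i, j)] then occurs exactly once in the product; changing its
sign preserves the law and negates the product. *)
Lemma expectation_term_eq0 i k j l : i != k -> j != l ->
  \int[mu]_x term i k j l x = 0.
Proof.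
move=> ik jl; pose e (p : pairs) := p == (i, j).
have : (\int[mu]_x (term i k j l (fun p => (-1) ^+ e p * x p)%R)%:E =
        \int[mu]_x (term i k j l x)%:E)%E.
  apply: (gaussian_flip e (f := EFin \o term i k j l)) => //.
  by apply/measurable_EFinP; exact: measurable_term.
move=> /(congr1 fine); rewrite -!/(Rintegral _ _ _).
have -> : (fun x : field_space R pairs => term i k j l (fun p => (-1) ^+ e p * x p)) =
    (fun x => -1 * term i k j l x).
  apply/funext => x; rewrite /term /e !xpair_eqE !eqxx /=.
  rewrite [k == i]eq_sym (negbTE ik) [l == j]eq_sym (negbTE jl) /= expr1 expr0.
  by ring.
by rewrite RintegralZl//; [lra|exact: integrable_term].
Qed.

(** Only the terms with [i = k] or [j = l] contribute, and there are at most
[2 * N ^ 3] of them. *)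
Lemma expectation_gram : \int[mu]_x gram x <= 2 * N%:R ^+ 3 * fourth_moment.
Proof.
rewrite (_ : gram = fun x => \sum_i \sum_k \sum_j \sum_l term i k j l x); last first.
  by apply/funext => x; exact: gramE.
rewrite Rintegral_sum; last first.
  by move=> i _; do 3 (apply: integrable_sumR => ? _); exact: integrable_term.
under eq_bigr => i _ do (rewrite Rintegral_sum; last first;
  first by move=> k _; do 2 (apply: integrable_sumR => ? _); exact: integrable_term).
under eq_bigr => i _ do under eq_bigr => k _ do (rewrite Rintegral_sum; last first;
  first by move=> j _; (apply: integrable_sumR => ? _); exact: integrable_term).
under eq_bigr => i _ do under eq_bigr => k _ do under eq_bigr => j _ do
  (rewrite Rintegral_sum; last first; first by move=> l _; exact: integrable_term).
apply: (@le_trans _ _ (\sum_(i < N) \sum_(k < N) \sum_(j < N) \sum_(l < N)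
   ((i == k)%:R + (j == l)%:R) * fourth_moment)).
  apply: ler_sum => i _; apply: ler_sum => k _; apply: ler_sum => j _.
  apply: ler_sum => l _.
  have m0 := @fourth_moment_ge0 R; have := expectation_term_le i k j l.
  case: eqVneq => [_|ik]; case: eqVneq => [_|jl] /=; rewrite ?add0r ?addr0 ?mul1r.
  - by lra.
  - by [].
  - by [].
  - by rewrite mul0r expectation_term_eq0.
have sumc (c : R) : \sum_(i < N) c = N%:R * c.
  by rewrite sumr_const card_ord mulr_natl.
have s1 (i k j : 'I_N) : \sum_(l < N) ((i == k)%:R + (j == l)%:R) * fourth_moment =
    (N%:R * (i == k)%:R + 1) * fourth_moment :> R.
  by rewrite -mulr_suml big_split /= sumc sum_eq_natr.
have s2 (i : 'I_N) : \sum_(k < N) N%:R * ((N%:R * (i == k)%:R + 1) * fourth_moment) =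
    2 * N%:R ^+ 2 * fourth_moment :> R.
  rewrite -mulr_sumr -mulr_suml big_split /= sumc -mulr_sumr sum_eq_natr; ring.
under eq_bigr => i _ do under eq_bigr => k _ do under eq_bigr => j _ do rewrite s1.
under eq_bigr => i _ do under eq_bigr => k _ do rewrite sumc.
under eq_bigr => i _ do rewrite s2.
by rewrite sumc le_eqVlt; apply/orP; left; apply/eqP; ring.
Qed.

(** Cauchy-Schwarz twice: first in [j] to remove [v], then in the pair of row
indices to remove [u] from the resulting quadratic form of the Gram matrix. *)
Lemma bilinear_form4_le (x : field_space R pairs) (u v : 'I_N -> R) :
  (forall i, `|u i| <= 1) -> (forall j, `|v j| <= 1) ->
  (\sum_i \sum_j u i * x (i, j) * v j) ^+ 4 <= N%:R ^+ 4 * gram x.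
Proof.
move=> u1 v1; pose c j := \sum_i u i * x (i, j).
have sq1 (y : R) : `|y| <= 1 -> y ^+ 2 <= 1.
  by rewrite -(real_normK (num_real y)) => y1; rewrite expr_le1.
have -> : \sum_i \sum_j u i * x (i, j) * v j = \sum_j c j * v j.
  by rewrite exchange_big; apply: eq_bigr => j _; rewrite mulr_suml.
have h1 : (\sum_j c j * v j) ^+ 2 <= N%:R * \sum_j c j ^+ 2.
  apply: le_trans (sqr_sum_le _) _; rewrite card_ord ler_wpM2l//.
  apply: ler_sum => j _; rewrite exprMn ler_piMr ?sqr_ge0//; exact: sq1.
have h2 : (\sum_j c j ^+ 2) ^+ 2 <= N%:R ^+ 2 * gram x.
  have -> : \sum_j c j ^+ 2 = \sum_(p : pairs) u p.1 * u p.2 *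
      \sum_j x (p.1, j) * x (p.2, j).
    rewrite -(pair_bigA _ (fun i k => u i * u k * \sum_j x (i, j) * x (k, j))) /=.
    under eq_bigr => j _ do rewrite expr2 /c big_distrlr /=.
    rewrite exchange_big; apply: eq_bigr => i _.
    rewrite exchange_big; apply: eq_bigr => k _; rewrite mulr_sumr.
    by apply: eq_bigr => j _; ring.
  apply: le_trans (sqr_sum_le _) _.
  rewrite card_prod card_ord natrM -expr2 ler_wpM2l ?sqr_ge0//.
  rewrite /gram pair_bigA /=; apply: ler_sum => -[i k] _ /=.
  rewrite !exprMn ler_piMl ?sqr_ge0//.
  have := sq1 _ (u1 i); have := sq1 _ (u1 k).
  have := sqr_ge0 (u i); have := sqr_ge0 (u k); nra.
have e4 (y : R) : y ^+ 4 = (y ^+ 2) ^+ 2 by rewrite -exprM.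
rewrite !e4.
have N0 : 0 <= N%:R :> R by [].
have s0 := sqr_ge0 (\sum_j c j * v j).
apply: (@le_trans _ _ ((N%:R * \sum_j c j ^+ 2) ^+ 2)).
  by rewrite lerXn2r ?nnegrE// (le_trans s0).
rewrite exprMn [(_ ^+ 2) ^+ 2]expr2 -mulrA ler_wpM2l ?sqr_ge0//.
Qed.

End Gram.

Section NormMoments.
Context {R : realType} {I : finType} (mu : probability (field_space R I) R).
Hypothesis gmu : gaussian_field mu.
Local Notation kappa := (1 + @fourth_moment R).

Definition norm1 (x : field_space R I) : R := \sum_i `|x i|.

Lemma norm1_ge0 x : 0 <= norm1 x. Proof. exact: sumr_ge0. Qed.

Lemma measurable_norm_coord i : measurable_fun setT (fun x : field_space R I => `|x i|).
Proof. by apply: measurableT_comp => //; exact: measurable_coord. Qed.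

Lemma integrable_norm_coord i : mu.-integrable setT (EFin \o (fun x => `|x i|)).
Proof.
apply: (integrable_le_quartic gmu (C := 1)); first exact: measurable_norm_coord.
by move=> x; rewrite mul1r normr_id (le_trans (norm_le_quartic _))// le_quartic_coord.
Qed.

Lemma integrable_sqr_coord i : mu.-integrable setT (EFin \o (fun x => x i ^+ 2)).
Proof.
apply: (integrable_le_quartic gmu (C := 1)).
  by apply: measurable_funX; exact: measurable_coord.
move=> x; rewrite mul1r ger0_norm ?sqr_ge0//.
by rewrite (le_trans (sqr_le_quartic _))// le_quartic_coord.
Qed.

Lemma integrable_one_coord4 i : mu.-integrable setT (EFin \o (fun x => 1 + x i ^+ 4)).
Proof.
apply: integrable_addR; last exact: integrable_coord4.
exact: finite_measure_integrable_cst.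
Qed.

Lemma Rintegral_probability_cst (c : R) : \int[mu]_x c = c.
Proof.
rewrite Rintegral_cst//.
by rewrite (congr1 fine (probability_setT mu) : fine (mu setT) = 1) mulr1.
Qed.

Lemma expectation_one_coord4 i : \int[mu]_x (1 + x i ^+ 4) = kappa.
Proof.
rewrite RintegralD//; [|exact: finite_measure_integrable_cst|exact: integrable_coord4].
by rewrite Rintegral_probability_cst expectation_coord4.
Qed.

Lemma expectation_norm_coord i : \int[mu]_x `|x i| <= kappa.
Proof.
rewrite -(expectation_one_coord4 i); apply: le_Rintegral => //.
- exact: integrable_norm_coord.
- exact: integrable_one_coord4.
- by move=> x _; exact: norm_le_quartic.
Qed.

Lemma expectation_sqr_coord i : \int[mu]_x x i ^+ 2 <= kappa.
Proof.
rewrite -(expectation_one_coord4 i); apply: le_Rintegral => //.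
- exact: integrable_sqr_coord.
- exact: integrable_one_coord4.
- by move=> x _; exact: sqr_le_quartic.
Qed.

Lemma integrable_norm1 : mu.-integrable setT (EFin \o norm1).
Proof. by apply: integrable_sumR => i _; exact: integrable_norm_coord. Qed.

Lemma expectation_norm1 : \int[mu]_x norm1 x <= #|I|%:R * kappa.
Proof.
rewrite Rintegral_sum; last by move=> i _; exact: integrable_norm_coord.
by rewrite mulr_natl -sumr_const; apply: ler_sum => i _; exact: expectation_norm_coord.
Qed.

Lemma sqr_norm1_le x : norm1 x ^+ 2 <= #|I|%:R * \sum_i x i ^+ 2.
Proof.
apply: le_trans (sqr_sum_le _) _; rewrite ler_wpM2l//.
by apply: ler_sum => i _; rewrite real_normK ?num_real.
Qed.

Lemma integrable_sqr_norm1_bound :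
  mu.-integrable setT (EFin \o (fun x => #|I|%:R * \sum_i x i ^+ 2)).
Proof. by apply/integrable_mulR/integrable_sumR => i _; exact: integrable_sqr_coord. Qed.

Lemma integrable_sqr_norm1 : mu.-integrable setT (EFin \o (fun x => norm1 x ^+ 2)).
Proof.
apply: (le_integrable measurableT _ _ integrable_sqr_norm1_bound).
  apply/measurable_EFinP; apply: measurable_funX; apply: measurable_sum => i.
  exact: measurable_norm_coord.
move=> x _ /=; rewrite lee_fin ger0_norm ?sqr_ge0//.
exact: le_trans (sqr_norm1_le x) (ler_norm _).
Qed.

Lemma expectation_sqr_norm1 : \int[mu]_x norm1 x ^+ 2 <= #|I|%:R ^+ 2 * kappa.
Proof.
apply: (@le_trans _ _ (\int[mu]_x (#|I|%:R * \sum_i x i ^+ 2))).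
  apply: le_Rintegral => //; first exact: integrable_sqr_norm1.
    exact: integrable_sqr_norm1_bound.
  by move=> x _; exact: sqr_norm1_le.
rewrite RintegralZl//; last by apply: integrable_sumR => i _; exact: integrable_sqr_coord.
rewrite expr2 -mulrA ler_wpM2l// Rintegral_sum; last by move=> i _; exact: integrable_sqr_coord.
by rewrite mulr_natl -sumr_const; apply: ler_sum => i _; exact: expectation_sqr_coord.
Qed.

End NormMoments.

(** * Gauge symmetry of the Hamiltonian *)

Lemma sum_expR_gt0 {R : realType} (C : finType) (b : R) (h : C -> R) (A : {set C}) s0 : s0 \in A ->
  0 < \sum_(s in A) expR (b * h s).
Proof.
move=> s0A; rewrite (bigD1 s0)//= ltr_wpDr ?expR_gt0//.
by apply: sumr_ge0 => t _; exact: expR_ge0.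
Qed.

Section Gauge.
Context {R : realType} {N : nat}.
Implicit Types (g : 'I_N -> 'I_N -> R) (s eta : config N).

(** In the group with two elements, equality of two sums depends only on the
equalities of the summands; this is where having two colors matters. *)
Lemma ord2_addr_eq (a b c e : 'I_2) : (a + c == b + e) = ((a == b) == (c == e)).
Proof.
by case: a b c e => [[|[|a]] ?] // [[|[|b]] ?] // [[|[|c]] ?] // [[|[|e]] ?].
Qed.

Definition gauge eta g : 'I_N -> 'I_N -> R :=
  fun i j => (-1) ^+ (eta i != eta j) * g i j.

Lemma hamiltonian_gauge g eta s : hamiltonian (gauge eta g) s =
  hamiltonian g (s + eta) - (Num.sqrt N%:R)^-1 * \sum_i \sum_j g i j * (eta i != eta j)%:R.
Proof.
rewrite /hamiltonian -mulrBr; congr (_ * _).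
rewrite -sumrB; apply: eq_bigr => i _; rewrite -sumrB; apply: eq_bigr => j _.
rewrite /gauge !ffunE ord2_addr_eq.
by case: (s i == s j); case: (eta i == eta j) => /=;
  rewrite ?expr0 ?expr1 ?mulN1r ?mul1r ?mulr1 ?mulr0 ?subr0 ?sub0r ?oppr0 ?subrr.
Qed.

(** An additive constant in the energy changes neither the normalized
exponential weights nor the set of maximizers. *)
Lemma gibbs_mass_shift (beta : \bar R) g g' eta (c : R) :
  (forall s, hamiltonian g' s = hamiltonian g (s + eta) - c) ->
  forall s, gibbs_mass beta g' s = gibbs_mass beta g (s + eta).
Proof.
move=> gg' s; have etaI : injective (fun s : config N => s + eta) by exact: addIr.
case: beta => [b| |] //=.
  have -> : partition_function b g [set: config N] =
      expR (b * c) * partition_function b g' [set: config N].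
    rewrite /partition_function mulr_sumr (reindex_inj etaI) /=.
    apply: eq_big => [t|t _]; first by rewrite !finset.in_setT.
    by rewrite -expRD gg'; congr expR; ring.
  rewrite gg' mulrBr expRD expRN invfM.
  by rewrite [RHS]mulrA.
have mE t : (t \in maximizers g') = (t + eta \in maximizers g).
  rewrite !inE; apply/forallP/forallP => h u; last first.
    by rewrite !gg' lerB// h.
  by have := h (u - eta); rewrite !gg' subrK lerD2r.
rewrite mE; congr (_ / _%:R); rewrite -(card_imset _ etaI).
apply: eq_card => t; apply/imsetP/idP => [[u mu ->]|mt]; first by rewrite -mE.
by exists (t - eta); rewrite ?subrK// mE subrK.
Qed.

Lemma partition_function_gt0 (b : R) g (A : {set config N}) s :
  s \in A -> 0 < partition_function b g A.
Proof. exact: sum_expR_gt0. Qed.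

Lemma maximizers_neq0 g : exists s, s \in maximizers g.
Proof.
pose s0 : config N := [ffun=> ord0].
have [s _ smax] := @arg_maxP _ _ _ s0 xpredT (hamiltonian g) isT.
by exists s; rewrite inE; apply/forallP => t; exact: smax.
Qed.

Lemma sum_gibbs_mass (beta : \bar R) g : (0 <= beta)%E ->
  \sum_s gibbs_mass beta g s = 1.
Proof.
case: beta => [b _|_|//] /=.
  rewrite -mulr_suml.
  have -> : \sum_s expR (b * hamiltonian g s) = partition_function b g [set: config N].
    by apply: eq_big => s; rewrite ?finset.in_setT.
  rewrite divff// gt_eqF//; apply: (partition_function_gt0 _ _ (s := [ffun=> ord0])).
  exact: finset.in_setT.
rewrite -mulr_suml.
have -> : \sum_s (s \in maximizers g)%:R = #|maximizers g|%:R :> R.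
  by rewrite -sum1_card natr_sum [RHS]big_mkcond; apply: eq_bigr => s _; case: ifP.
have [s sm] := maximizers_neq0 g.
by rewrite divff// pnatr_eq0 -lt0n; apply/card_gt0P; exists s.
Qed.

Lemma gibbs_mass_ge0 (beta : \bar R) g s : 0 <= gibbs_mass beta g s.
Proof.
case: beta => [b| |] /=; [|by rewrite divr_ge0 ?ler0n|exact: lexx].
by rewrite divr_ge0 ?expR_ge0// sumr_ge0// => t _; exact: expR_ge0.
Qed.

Lemma gibbs_mass_le1 (beta : \bar R) g s : (0 <= beta)%E -> gibbs_mass beta g s <= 1.
Proof.
move=> b0; rewrite -(sum_gibbs_mass g b0) (bigD1 s)//= lerDl sumr_ge0// => t _.
exact: gibbs_mass_ge0.
Qed.

End Gauge.

(** * Concentration of the magnetization under the uniform measure *)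

(** For [x] beyond 1 both exponentials are below [exp (x ^+ 2)]; on [0, 1] the
bounds [exp w <= 1 / (1 - w)] and [exp (- w) <= 1 / (1 + w)] at [w = x / 2]
reduce the claim to a polynomial inequality. *)
Lemma cosh_le_expR_sqr {R : realType} (x : R) :
  expR x + expR (- x) <= 2 * expR (x ^+ 2).
Proof.
wlog x0 : x / 0 <= x.
  move=> h; have [|/ltW x0] := leP 0 x; first exact: h.
  by have := h (- x); rewrite oppr_ge0 opprK sqrrN addrC; apply.
have [x1|x1] := leP 1 x.
  have e1 : expR x <= expR (x ^+ 2) by rewrite ler_expR; nra.
  have e2 : expR (- x) <= expR (x ^+ 2) by rewrite ler_expR; nra.
  lra.
set w := x / 2; have w0 : 0 <= w by rewrite divr_ge0.
have w1 : w < 2^-1 by rewrite /w; lra.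
have expA : expR w <= (1 - w)^-1.
  by rewrite -[w]opprK expRN opprK lef_pV2 ?posrE ?expR_gt0 ?expR_ge1Dx//; lra.
have expB : expR (- w) <= (1 + w)^-1.
  by rewrite expRN lef_pV2 ?posrE ?expR_gt0 ?expR_ge1Dx//; lra.
have -> : x = w + w by rewrite /w; field.
have -> : (w + w) ^+ 2 = 2 * w ^+ 2 + 2 * w ^+ 2 by ring.
rewrite opprD !expRD; set A := expR w in expA *; set B := expR (- w) in expB *.
have A0 : 0 < A by exact: expR_gt0.
have B0 : 0 < B by exact: expR_gt0.
have := expR_ge1Dx (2 * w ^+ 2); set E := expR _ => hE.
have A2 : A * A <= (1 - w)^-1 * (1 - w)^-1 by apply: ler_pM => //; exact: ltW.
have B2 : B * B <= (1 + w)^-1 * (1 + w)^-1 by apply: ler_pM => //; exact: ltW.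
apply: (le_trans (lerD A2 B2)).
have -> : (1 - w)^-1 * (1 - w)^-1 + (1 + w)^-1 * (1 + w)^-1 =
    2 * (1 + w ^+ 2) / ((1 - w ^+ 2) ^+ 2).
  have n1 : 1 - w != 0 by rewrite gt_eqF//; lra.
  have n2 : 1 + w != 0 by rewrite gt_eqF//; lra.
  have n3 : 1 - w ^+ 2 != 0 by rewrite gt_eqF//; nra.
  by field; rewrite n1 n2 n3.
set u := w ^+ 2 in hE *.
have u0 : 0 <= u by rewrite sqr_ge0.
have u1 : u <= 4^-1 by rewrite /u; nra.
rewrite ler_pdivrMr; last by rewrite exprn_gt0//; lra.
rewrite -mulrA ler_pM2l//.
apply: (@le_trans _ _ ((1 + 2 * u) * (1 + 2 * u) * (1 - u) ^+ 2)); first by nra.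
by rewrite ler_wpM2r ?sqr_ge0// ler_pM//; lra.
Qed.

Section Hoeffding.
Context {R : realType} {N : nat}.
Implicit Types s : config N.

Definition count0 s : nat := #|[set i | s i == ord0]%SET|.

(** The sum of the spins, +1 for the color [ord0] and -1 for the other one. *)
Definition spin_sum s : R := 2 * (count0 s)%:R - N%:R.

Lemma count0_le s : (count0 s <= N)%N.
Proof. by rewrite -[X in (_ <= X)%N]card_ord max_card. Qed.

Lemma count1E s : #|[set i | s i == lift ord0 ord0]%SET| = (N - count0 s)%N.
Proof.
have -> : [set i | s i == lift ord0 ord0]%SET = (~: [set i | s i == ord0])%SET.
  by apply/setP => i; rewrite !inE; case: (s i) => [[|[|j]] ?].
by rewrite cardsCs finset.setCK card_ord.
Qed.

(** The two entries of the deviation are opposite, so the sup norm is the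
absolute value of either. *)
Lemma norm_magnetization s : (0 < N)%N ->
  `|magnetization s - 2^-1 *: const_mx 1 : 'rV[R]_2| = `|spin_sum s| / (2 * N%:R).
Proof.
move=> N0; have Nn : N%:R != 0 :> R by rewrite pnatr_eq0 -lt0n.
have entry a : `|(magnetization s - 2^-1 *: const_mx 1 : 'rV[R]_2) ord0 a| =
    `|spin_sum s| / (2 * N%:R).
  rewrite !mxE; have -> : `|spin_sum s| / (2 * N%:R) = `|spin_sum s / (2 * N%:R)|.
    by rewrite normrM normfV [`|2 * _|]ger0_norm// mulr_ge0.
  have [->|a0] := eqVneq a ord0.
    congr `|_|; rewrite /spin_sum /count0; field; exact: Nn.
  have -> : a = lift ord0 ord0.
    by apply/val_inj; case: a a0 => [[|[|k]] ?].
  rewrite count1E natrB ?count0_le// -normrN; congr `|_|; rewrite /spin_sum.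
  by field; exact: Nn.
rewrite [LHS]mx_normrE; apply/le_anti/andP; split.
  apply/bigmax_leP; split; first by rewrite divr_ge0 ?mulr_ge0.
  by move=> [i a] _ /=; rewrite (ord1 i) entry.
apply: le_trans (le_bigmax _ _ (ord0, ord0)) => /=.
by rewrite entry.
Qed.

(** The moment generating function of a sum of independent coins factorizes. *)
Lemma sum_expR_spin (t : R) :
  \sum_(s : config N) expR (t * spin_sum s) = (expR t + expR (- t)) ^+ N.
Proof.
pose F (i : 'I_N) (a : 'I_2) : R := if a == ord0 then expR t else expR (- t).
have -> : (expR t + expR (- t)) ^+ N = \prod_i \sum_a F i a.
  under eq_bigr => i _ do rewrite big_ord_recl big_ord1 /F /=.
  by rewrite prodr_const card_ord.
rewrite bigA_distr_bigA /=; apply: eq_bigr => s _.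
rewrite /F (eq_bigr (fun i => expR (t * (2 * (s i == ord0)%:R - 1)))); last first.
  by move=> i _; case: ifP => _; congr expR; rewrite ?mulr1 ?mulr0; ring.
rewrite -expR_sum -mulr_sumr; congr expR; congr (_ * _).
rewrite big_split /= -mulr_sumr sumr_const card_ord mulNrn /spin_sum.
congr (_ * _ - _); rewrite /count0 -sum1_card natr_sum big_mkcond /=.
by apply: eq_bigr => i _; rewrite inE; case: (_ == _).
Qed.

(** Chernoff's method for both tails with the parameter [eps]: each contributes
[exp (- 2 eps^2 N)] times the moment generating function, which is at most
[2 ^ N * exp (eps^2 N)]. *)
Lemma card_unbalanced (eps : R) : (0 < N)%N -> 0 < eps ->
  #|unbalanced eps : {set config N}|%:R <= 2 ^+ N * (2 * expR (- (eps ^+ 2 * N%:R))).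
Proof.
move=> N0 e0; have Np : 0 < N%:R :> R by rewrite ltr0n.
set c := expR (- (2 * eps ^+ 2 * N%:R)).
apply: (@le_trans _ _ (\sum_(s : config N)
   c * (expR (eps * spin_sum s) + expR (- eps * spin_sum s)))).
  rewrite -sum1_card natr_sum big_mkcond /=; apply: ler_sum => s _.
  have p1 := expR_gt0 (eps * spin_sum s); have p2 := expR_gt0 (- eps * spin_sum s).
  have c0 : 0 < c by exact: expR_gt0.
  case: ifP => [|_]; last by nra.
  rewrite inE norm_magnetization// ler_pdivlMr ?mulr_gt0// => h.
  have {h} [h|h] : 2 * eps * N%:R <= spin_sum s \/ 2 * eps * N%:R <= - spin_sum s.
  - by move: h; case: (ler0P (spin_sum s)) => _; [right|left]; lra.
  - apply: (@le_trans _ _ (c * expR (eps * spin_sum s))); last by nra.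
    by rewrite -expRD -[X in X <= _]expR0 ler_expR; have := ler_wpM2l (ltW e0) h; lra.
  - apply: (@le_trans _ _ (c * expR (- eps * spin_sum s))); last by nra.
    by rewrite -expRD -[X in X <= _]expR0 ler_expR; have := ler_wpM2l (ltW e0) h; lra.
rewrite -mulr_sumr big_split /= !sum_expR_spin opprK [expR (- eps) + _]addrC.
have h : (expR eps + expR (- eps)) ^+ N <= 2 ^+ N * expR (eps ^+ 2 * N%:R).
  rewrite expRM_natr -exprMn lerXn2r ?nnegrE ?addr_ge0 ?mulr_ge0 ?expR_ge0//.
  exact: cosh_le_expR_sqr.
have -> : expR (- (eps ^+ 2 * N%:R)) = c * expR (eps ^+ 2 * N%:R).
  by rewrite -expRD; congr expR; ring.
have : 0 < c by exact: expR_gt0.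
by nra.
Qed.

End Hoeffding.

(** * The mean Gibbs measure is uniform *)

Section GibbsMean.
Context {R : realType} {N : nat}.
Local Notation pairs := ('I_N * 'I_N)%type.
Implicit Types (x : field_space R pairs) (s eta : config N).

Definition curried x : 'I_N -> 'I_N -> R := fun i j => x (i, j).

Local Notation H x := (hamiltonian (curried x)).

Lemma measurable_hamiltonian s : measurable_fun setT (fun x => H x s).
Proof.
apply: measurable_funM => //; apply: measurable_sum => i; apply: measurable_sum => j.
by apply: measurable_funM => //; exact: measurable_coord.
Qed.

Lemma measurable_ler01 (d : measure_display) (T : measurableType d) (f g : T -> R) :
  measurable_fun setT f -> measurable_fun setT g ->
  measurable_fun setT (fun x : T => (f x <= g x)%R%:R : R).
Proof.
move=> mf mg; have -> : (fun x : T => (f x <= g x)%R%:R : R) =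
    (fun x : T => if f x <= g x then 1 else 0).
  by apply/funext => x; case: ifP.
by apply: measurable_fun_ifT => //; exact: measurable_fun_ler.
Qed.

Lemma maximizers_prod (h : 'I_N -> 'I_N -> R) s :
  (s \in maximizers h)%:R = \prod_t (hamiltonian h t <= hamiltonian h s)%R%:R :> R.
Proof.
rewrite inE; case: (boolP [forall t, _]) => [/forallP h1|].
  by rewrite big1// => t _; rewrite h1.
rewrite negb_forall => /existsP[t /negbTE ht].
by rewrite (bigD1 t)//= ht mul0r.
Qed.

(** Division by a positive function is written with [expR] and [ln], and
membership among the maximizers as a product of indicators. *)
Lemma measurable_gibbs_mass (beta : \bar R) s :
  measurable_fun setT (fun x => gibbs_mass beta (curried x) s).
Proof.
have divE (a b : R) : 0 < b -> a / b = a * expR (- ln b).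
  by move=> b0; rewrite expRN lnK.
case: beta => [b| |] //=.
  have Zp x := partition_function_gt0 b (curried x) (finset.in_setT s).
  apply: (eq_measurable_fun (fun x : field_space R pairs => expR (b * H x s) *
    expR (- ln (\sum_(t in [set: config N]%SET) expR (b * H x t))))).
    by move=> x _; rewrite -divE; [|exact: Zp].
  apply: measurable_funM.
    by apply: measurableT_comp => //; apply: measurable_funM => //; exact: measurable_hamiltonian.
  apply: measurableT_comp => //; apply: measurable_funN; apply: measurableT_comp => //.
  apply: (eq_measurable_fun (fun x : field_space R pairs =>
    \sum_(t <- enum [set: config N]%SET) expR (b * H x t))).
    by move=> x _; rewrite big_enum.
  apply: measurable_sum => t; apply: measurableT_comp => //.
  by apply: measurable_funM => //; exact: measurable_hamiltonian.
have mM t : measurable_fun setT (fun x => (t \in maximizers (curried x))%:R : R).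
  apply: (eq_measurable_fun (fun x : field_space R pairs =>
    \prod_u (H x u <= H x t)%R%:R : R)); first by move=> x _; rewrite maximizers_prod.
  by apply: measurable_prod => u _; apply: measurable_ler01; exact: measurable_hamiltonian.
have cardE x : #|maximizers (curried x)|%:R = \sum_t (t \in maximizers (curried x))%:R :> R.
  by rewrite -sum1_card natr_sum big_mkcond; apply: eq_bigr => t _; case: (_ \in _).
have cardp x : 0 < #|maximizers (curried x)|%:R :> R.
  have [t tm] := maximizers_neq0 (curried x).
  by rewrite ltr0n; apply/card_gt0P; exists t.
apply: (eq_measurable_fun (fun x : field_space R pairs =>
  (s \in maximizers (curried x))%:R *
  expR (- ln (\sum_t (t \in maximizers (curried x))%:R)) : R)).
  by move=> x _; rewrite -cardE -divE; [|exact: cardp].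
apply: measurable_funM => //.
apply: measurableT_comp => //; apply: measurable_funN; apply: measurableT_comp => //.
exact: measurable_sum.
Qed.

Variable mu : probability (field_space R pairs) R.
Hypothesis gmu : gaussian_field mu.

Lemma integrable_gibbs_mass (beta : \bar R) s : (0 <= beta)%E ->
  mu.-integrable setT (EFin \o (fun x => gibbs_mass beta (curried x) s)).
Proof.
move=> b0; apply: (integrable_le_quartic gmu (C := 1)).
  exact: measurable_gibbs_mass.
move=> x; rewrite mul1r ger0_norm ?gibbs_mass_ge0//.
exact: le_trans (gibbs_mass_le1 _ _ b0) (quartic_ge1 x).
Qed.

(** The mean mass is the same for all configurations, by gauge invariance, and
the masses add up to 1. *)
Lemma expectation_gibbs_mass (beta : \bar R) s : (0 <= beta)%E ->
  \int[mu]_x gibbs_mass beta (curried x) s = 2^-1 ^+ N.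
Proof.
move=> b0; pose m t := \int[mu]_x gibbs_mass beta (curried x) t.
have inv t eta : m (t + eta) = m t.
  have : (\int[mu]_x (gibbs_mass beta
      (curried (fun p => (-1) ^+ (eta p.1 != eta p.2) * x p)%R) t)%:E =
        \int[mu]_x (gibbs_mass beta (curried x) t)%:E)%E.
    apply: (gaussian_flip (fun p => eta p.1 != eta p.2)
      (f := fun x => (gibbs_mass beta (curried x) t)%:E)) => //.
    by apply/measurable_EFinP; exact: measurable_gibbs_mass.
  move=> /(congr1 fine); rewrite -!/(Rintegral _ _ _) -/(m t) => <-.
  apply: eq_Rintegral => x _; apply/esym/gibbs_mass_shift => u.
  exact: hamiltonian_gauge.
have tot : \sum_t m t = 1.
  rewrite -Rintegral_sum; last by move=> t _; exact: integrable_gibbs_mass.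
  under eq_Rintegral do rewrite sum_gibbs_mass//.
  by rewrite Rintegral_cst// mul1r; exact: (congr1 fine (probability_setT mu)).
have : \sum_(t : config N) m s = 1.
  by rewrite -tot; apply: eq_bigr => t _; rewrite -(inv s (t - s)) addrC subrK.
rewrite sumr_const card_ffun !card_ord -[LHS]mulr_natl natrX -/(m s) => h.
have n2 : 2 ^+ N != 0 :> R by rewrite expf_neq0// pnatr_eq0.
by rewrite exprVn; apply: (mulfI n2); rewrite divff.
Qed.

Lemma expectation_gibbs (beta : \bar R) (A : {set config N}) : (0 <= beta)%E ->
  \int[mu]_x gibbs beta (curried x) A = #|A|%:R / 2 ^+ N.
Proof.
move=> b0; rewrite Rintegral_sum; last by move=> t _; exact: integrable_gibbs_mass.
under eq_bigr do rewrite expectation_gibbs_mass//.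
by rewrite sumr_const exprVn -[LHS]mulr_natl.
Qed.

Lemma integrable_gibbs (beta : \bar R) (A : {set config N}) : (0 <= beta)%E ->
  mu.-integrable setT (EFin \o (fun x => gibbs beta (curried x) A)).
Proof. by move=> b0; apply: integrable_sumR => s _; exact: integrable_gibbs_mass. Qed.

Lemma expectation_gibbs_unbalanced (beta : \bar R) (eps : R) :
  (0 <= beta)%E -> 0 < eps -> (0 < N)%N ->
  \int[mu]_x gibbs beta (curried x) (unbalanced eps) <= 2 * expR (- (eps ^+ 2 * N%:R)).
Proof.
move=> b0 e0 N0; rewrite expectation_gibbs// ler_pdivrMr ?exprn_gt0// mulrC.
exact: card_unbalanced.
Qed.

End GibbsMean.

Lemma mean_gibbs_unbalanced {R : realType} (d : measure_display) (T : measurableType d)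
    (P : probability T R) (N : nat) (g : 'I_N -> 'I_N -> {RV P >-> R})
    (beta : \bar R) (eps : R) :
  iid_standard_normal g -> (0 <= beta)%E -> 0 < eps -> (0 < N)%N ->
  (mean_gibbs g beta (unbalanced eps) <= (2 * expR (- (eps ^+ 2 * N%:R)))%:E)%E.
Proof.
move=> giid b0 e0 N0; have [mu gmu law] := iid_gaussian_field giid.
have ig := integrable_gibbs gmu (unbalanced eps) b0.
rewrite /mean_gibbs unlock.
have -> : (\int[P]_w (gibbs beta (couplings g w) (unbalanced eps))%:E =
    \int[mu]_x (gibbs beta (curried x) (unbalanced eps))%:E)%E.
  rewrite -(law (fun x => (gibbs beta (curried x) (unbalanced eps))%:E))//.
  exact: (measurable_int _ ig).
rewrite -[X in (X <= _)%E]fineK; last exact: integrable_fin_num.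
by rewrite lee_fin; exact: expectation_gibbs_unbalanced.
Qed.

(** * Free energy and ground state as one functional *)

Section Pressure.
Context {R : realType}.

(** The functional whose mean is the free energy for [beta] finite and the
ground state energy for [beta] infinite, before division by N. *)
Definition pressure (beta : \bar R) (C : finType) (h : C -> R) (A : {set C}) : R :=
  match beta with
  | b%:E%E => ln (\sum_(s in A) expR (b * h s))
  | +oo%E => sup [set h s | s in [set` A]]
  | -oo%E => 0
  end.

(** The Lipschitz constant of the pressure with respect to the energy. *)
Definition weight (beta : \bar R) : R := if beta is b%:E%E then b else 1.

Lemma weight_ge0 beta : (0 <= beta)%E -> 0 <= weight beta.
Proof. by case: beta => [b| |] //=; rewrite lee_fin. Qed.

Lemma sup_finset (C : finType) (h : C -> R) (A : {set C}) s0 : s0 \in A ->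
  exists s, [/\ s \in A, sup [set h s | s in [set` A]] = h s &
    forall t, t \in A -> h t <= h s].
Proof.
move=> s0A; have [s sA smax] := @arg_maxP _ _ _ s0 (mem A) h s0A.
exists s; split=> //; apply/le_anti/andP; split.
  apply: ge_sup; first by exists (h s0), s0.
  by move=> _ [t tA <-]; exact: smax.
apply: ub_le_sup; last by exists s.
by exists (h s) => _ [t tA <-]; exact: smax.
Qed.

(** The comparison principle: moving configurations by a map with fibers of size
at most [K] that loses at most [Delta] in energy costs at most [ln K] in entropy
and [weight beta * Delta] in energy. *)
Lemma pressure_le_map (beta : \bar R) (C D : finType) (r : C -> D)
    (h : C -> R) (k : D -> R) (A : {set C}) (B : {set D}) (K : nat) (Delta : R) s0 :
  (0 <= beta)%E -> s0 \in A -> (forall s, s \in A -> r s \in B) ->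
  (forall s, s \in A -> h s <= k (r s) + Delta) ->
  (forall t, t \in B -> (#|[set s in A | r s == t]%SET| <= K)%N) ->
  pressure beta h A <= pressure beta k B + ln K%:R + weight beta * Delta.
Proof.
move=> beta0 s0A rB hk fib.
have K0 : (0 < K)%N.
  apply: leq_trans (fib _ (rB _ s0A)); apply/card_gt0P; exists s0.
  by rewrite !inE s0A eqxx.
case: beta beta0 => [b| |] //= b0; last first.
  have [s [sA -> _]] := sup_finset h s0A.
  have [t [_ -> tmax]] := sup_finset k (rB _ s0A).
  have := hk _ sA; have := tmax _ (rB _ sA); have : 0 <= ln K%:R :> R.
    by rewrite ln_ge0// ler1n.
  by lra.
rewrite lee_fin in b0.
have Bp := sum_expR_gt0 b k (rB _ s0A); have Ap := sum_expR_gt0 b h s0A.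
have Kp : 0 < K%:R :> R by rewrite ltr0n.
rewrite -lnM ?posrE// -[b * Delta]expRK -lnM ?posrE ?mulr_gt0 ?expR_gt0//.
rewrite ler_ln ?posrE ?mulr_gt0 ?expR_gt0//.
rewrite (partition_big r (mem B))//= -mulrA mulr_suml; apply: ler_sum => t tB.
apply: (@le_trans _ _ (\sum_(s in A | r s == t) expR (b * k t) * expR (b * Delta))).
  apply: ler_sum => s /andP[sA /eqP rs]; rewrite -expRD ler_expR -mulrDr -rs.
  by rewrite ler_wpM2l// hk.
rewrite sumr_const; have := expR_ge0 (b * k t); have := expR_ge0 (b * Delta).
set E1 := expR _; set E2 := expR _ => E1p E2p.
rewrite -[leLHS]mulr_natl mulrCA ler_wpM2l// ler_wpM2r// ler_nat.
apply: leq_trans (fib _ tB).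
by rewrite leq_eqVlt; apply/orP; left; apply/eqP/eq_card => s; rewrite inE.
Qed.

Lemma pressure_sub (beta : \bar R) (C : finType) (h : C -> R) (A B : {set C}) s0 :
  (0 <= beta)%E -> s0 \in A -> A \subset B -> pressure beta h A <= pressure beta h B.
Proof.
move=> b0 s0A AB.
have := @pressure_le_map beta _ _ id h h A B 1 0 s0 b0 s0A.
rewrite ln1 mulr0 !addr0; apply.
- by move=> s; exact: (fintype.subsetP AB).
- by move=> s _; rewrite addr0.
- move=> t _; rewrite -(cards1 t); apply: subset_leq_card.
  by apply/fintype.subsetP => s; rewrite !inE => /andP[].
Qed.

(** Comparison with a one-point system of energy [M] or [- M]. *)
Lemma pressure_norm_le (beta : \bar R) (C : finType) (h : C -> R) (A : {set C})
    (M : R) s0 :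
  (0 <= beta)%E -> s0 \in A -> (forall s, `|h s| <= M) ->
  `|pressure beta h A| <= ln #|C|%:R + weight beta * M.
Proof.
move=> b0 s0A hM; have hb s := hM s.
have w0 := weight_ge0 b0; have lnC : 0 <= ln #|C|%:R :> R.
  by rewrite ln_ge0// ler1n; apply/card_gt0P; exists s0.
have pt (c : R) : pressure beta (fun _ : unit => c) [set: unit] = weight beta * c.
  case: beta {w0} b0 => [b| |] //= _.
    by rewrite (eq_bigl (pred1 tt)) ?big_pred1_eq ?expRK// => -[]; rewrite finset.in_setT.
  have [s [_ -> _]] := sup_finset (fun _ : unit => c) (finset.in_setT tt).
  by rewrite mul1r.
have up := @pressure_le_map beta C unit (fun=> tt) h (fun=> M) A [set: unit] #|C| 0 s0 b0 s0A.
have lo := @pressure_le_map beta unit C (fun=> s0) (fun=> - M) h [set: unit] A 1 0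
  tt b0 (finset.in_setT tt).
rewrite ler_norml; apply/andP; split.
  move: lo; rewrite pt ln1 mulr0 !addr0 mulrN => lo; apply: le_trans (lo _ _ _).
  - by lra.
  - by move=> _ _; exact: s0A.
  - by move=> _ _; have := hM s0; rewrite ler_norml => /andP[].
  - by move=> t _; rewrite -card_unit max_card.
move: up; rewrite pt mulr0 !addr0 [weight _ * _ + _]addrC; apply.
- by move=> s _; rewrite finset.in_setT.
- by move=> s _; apply: le_trans (ler_norm _) _.
- by move=> t _; exact: max_card.
Qed.

Lemma measurable_pressure (beta : \bar R) (d : measure_display) (T : measurableType d)
    (C : finType) (h : T -> C -> R) (A : {set C}) s0 : s0 \in A ->
  (forall s, measurable_fun setT (fun x => h x s)) ->
  measurable_fun setT (fun x => pressure beta (h x) A).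
Proof.
move=> s0A mh; case: beta => [b| |] //=.
  apply: measurableT_comp => //.
  under eq_fun do rewrite -big_filter.
  apply: measurable_sum => s; apply: measurableT_comp => //.
  exact: measurable_funM.
have -> : (fun x => sup [set h x s | s in [set` A]]) =
    (fun x => \big[Num.max/h x s0]_(s <- enum A) h x s).
  apply/funext => x; have [s [sA -> smax]] := sup_finset (h x) s0A.
  apply/le_anti/andP; split.
    by apply: le_bigmax_seq => //; rewrite mem_enum.
  rewrite big_enum; apply: bigmax_le => [|t tA]; exact: smax.
elim: (enum A) => [|s r IH]; first by under eq_fun do rewrite big_nil; exact: mh.
under eq_fun do rewrite big_cons.
exact: measurable_maxr.
Qed.

End Pressure.

(** * Rebalancing a configuration by cheap flips *)

Section Flip.
Context {R : realType} {N : nat}.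
Implicit Types (g : 'I_N -> 'I_N -> R) (s : config N) (i : 'I_N) (c : 'I_2).

Definition flip_at s i : config N := [ffun j => if j == i then s j + 1 else s j].

Lemma flip_atK i : involutive (fun s => flip_at s i).
Proof.
move=> s; apply/ffunP => j; rewrite !ffunE; case: eqP => // _.
by apply/val_inj; case: (s j) => [[|[|k]] ?].
Qed.

Definition color_sign c s i : R := if s i == c then 1 else -1.

Lemma ord2_add1_eq (a b : 'I_2) : (a + 1 == b) = (b != a).
Proof. by case: a b => [[|[|a]] ?] // [[|[|b]] ?]. Qed.

Lemma sum_delta i (F : 'I_N -> R) : \sum_j F j * (j == i)%:R = F i.
Proof.
rewrite (bigD1 i)//= eqxx mulr1 big1 ?addr0// => j /negbTE ->.
by rewrite mulr0.
Qed.

(** Only the pairs that involve [i] change; the last correction compensates the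
diagonal pair, which is counted in both sums and does not change. *)
Lemma hamiltonian_flip g s i c : s i = c ->
  hamiltonian g (flip_at s i) = hamiltonian g s + (Num.sqrt N%:R)^-1 *
    (2 * g i i - \sum_j g i j * color_sign c s j - \sum_j color_sign c s j * g j i).
Proof.
move=> sic; apply/eqP; rewrite addrC -subr_eq; apply/eqP.
rewrite /hamiltonian -mulrBr; congr (_ * _); rewrite -sumrB.
pose e j k : R := 2 * g j k * (k == i)%:R * (j == i)%:R -
   g j k * color_sign c s k * (j == i)%:R - color_sign c s j * g j k * (k == i)%:R.
transitivity (\sum_j \sum_k e j k).
  apply: eq_bigr => j _; rewrite -sumrB; apply: eq_bigr => k _.
  rewrite /e /color_sign !ffunE -sic.
  have [->|ji] := eqVneq j i; have [->|ki] := eqVneq k i; rewrite ?eqxx /=.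
  - by ring.
  - by rewrite ord2_add1_eq [s i == s k]eq_sym; case: eqP => _ /=; ring.
  - by rewrite [s j == _]eq_sym ord2_add1_eq; case: (s j == s i) => /=; ring.
  - by rewrite subrr !mulr0 !subr0.
rewrite /e; under eq_bigr => j _ do rewrite !sumrB -!mulr_suml !sum_delta.
by rewrite !sumrB !sum_delta.
Qed.

(** Trades a fourth root for a free parameter, so that moments can be taken
without Jensen's inequality. *)
Lemma norm_le_fourth_power (r y : R) : 0 < r -> `|y| <= r + y ^+ 4 / r ^+ 3.
Proof.
move=> r0; have -> : y ^+ 4 = `|y| ^+ 4.
  by rewrite -normrX ger0_norm// exprn_even_ge0.
have := normr_ge0 y; set t := `|y| => t0.
have [tr|rt] := leP t r.
  by rewrite (le_trans tr)// lerDl divr_ge0 ?exprn_ge0// ltW.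
apply: (@le_trans _ _ (t ^+ 4 / r ^+ 3)); last by rewrite lerDr ltW.
rewrite ler_pdivlMr ?exprn_gt0// [t ^+ 4]exprS ler_wpM2l//.
by rewrite lerXn2r ?nnegrE// ltW.
Qed.

(** The bound on the average energy loss, with [2 / N] for the reciprocal of the
number of sites of the majority color, two bilinear forms bounded by
[norm_le_fourth_power] with parameter [r], and the diagonal terms. *)
Definition flip_cost (r : R) (x : field_space R ('I_N * 'I_N)%type) : R :=
  (Num.sqrt N%:R)^-1 * (2 / N%:R) *
  (2 * (\sum_i `|x (i, i)|) + 2 * (r + N%:R ^+ 4 * gram x / r ^+ 3)).

Lemma flip_cost_ge0 r x : 0 < r -> 0 <= flip_cost r x.
Proof.
move=> r0; rewrite /flip_cost !mulr_ge0 ?invr_ge0 ?sqrtr_ge0 ?divr_ge0//.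
rewrite addr_ge0 ?mulr_ge0 ?sumr_ge0//.
by rewrite addr_ge0 ?divr_ge0 ?mulr_ge0 ?exprn_ge0 ?gram_ge0// ltW.
Qed.

(** If every flip of a site of color [c] lost more than [flip_cost], so would
the average; but the sum of the losses is a combination of two bilinear forms
and a diagonal sum, with coefficients in [-1, 1]. *)
Lemma exists_cheap_flip r (x : field_space R ('I_N * 'I_N)%type) s c :
  (0 < N)%N -> 0 < r -> (N <= 2 * #|[set i | s i == c]%SET|)%N ->
  exists2 i, s i = c & hamiltonian (curried x) s <=
    hamiltonian (curried x) (flip_at s i) + flip_cost r x.
Proof.
move=> N0 r0; set S := [set i | s i == c]%SET => hS.
set h := hamiltonian (curried x).
have [/existsP[i /andP[/eqP sic hi]]|] :=
  boolP [exists i, (s i == c) && (h s <= h (flip_at s i) + flip_cost r x)].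
  by exists i.
rewrite negb_exists => /forallP nex; exfalso.
have lt_flip i : i \in S -> h (flip_at s i) - h s < - flip_cost r x.
  rewrite inE => si; have := nex i; rewrite si /= -ltNge; lra.
have Sgt0 : (0 < #|S|)%N by lia.
have [i0 i0S] : exists i, i \in S by apply/card_gt0P.
have sum_lt : \sum_(i in S) (h (flip_at s i) - h s) < #|S|%:R * - flip_cost r x.
  rewrite mulr_natl -sumr_const; apply: ltr_sum => //.
  by apply/hasP; exists i0; rewrite ?mem_index_enum.
pose u i : R := (s i == c)%:R; pose v := color_sign c s.
have u1 i : `|u i| <= 1 by rewrite /u; case: eqP => _; rewrite ?normr1 ?normr0.
have v1 i : `|v i| <= 1 by rewrite /v /color_sign; case: ifP => _; rewrite ?normrN normr1.
have sumS (F : 'I_N -> R) : \sum_(i in S) F i = \sum_i u i * F i.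
  rewrite big_mkcond; apply: eq_bigr => i _; rewrite inE /u.
  by case: eqP; rewrite ?mul1r ?mul0r.
have sumE : \sum_(i in S) (h (flip_at s i) - h s) = (Num.sqrt N%:R)^-1 *
    (2 * (\sum_i u i * x (i, i)) - \sum_i \sum_j u i * x (i, j) * v j -
     \sum_j \sum_i v j * x (j, i) * u i).
  transitivity (\sum_(i in S) (Num.sqrt N%:R)^-1 * (2 * x (i, i) -
      \sum_j x (i, j) * v j - \sum_j v j * x (j, i))).
    apply: eq_bigr => i; rewrite inE => /eqP sic.
    by rewrite /h (hamiltonian_flip _ sic) addrC addKr.
  rewrite -mulr_sumr !sumrB !sumS mulr_sumr; congr (_ * (_ - _ - _)).
  - by apply: eq_bigr => i _; ring.
  - by apply: eq_bigr => i _; rewrite mulr_sumr; apply: eq_bigr => j _; ring.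
  - rewrite [RHS]exchange_big; apply: eq_bigr => i _; rewrite mulr_sumr.
    by apply: eq_bigr => j _; ring.
pose D := \sum_i `|x (i, i)|; pose E := r + N%:R ^+ 4 * gram x / r ^+ 3.
have bD : `|\sum_i u i * x (i, i)| <= D.
  apply: le_trans (ler_norm_sum _ _ _) _; apply: ler_sum => i _.
  by rewrite normrM ler_piMl.
have bE (a b : 'I_N -> R) : (forall i, `|a i| <= 1) -> (forall i, `|b i| <= 1) ->
    `|\sum_i \sum_j a i * x (i, j) * b j| <= E.
  move=> a1 b1; apply: le_trans (norm_le_fourth_power _ r0) _.
  rewrite /E lerD2l ler_wpM2r ?invr_ge0 ?exprn_ge0 ?(ltW r0)//.
  exact: bilinear_form4_le.
have := bE _ _ u1 v1; have := bE _ _ v1 u1; have := bD.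
move: sum_lt; rewrite sumE !ler_norml.
set X := \sum_i _ * x (i, i); set Y := \sum_i \sum_j u i * _ * _.
set Z := \sum_i \sum_j v i * _ * _.
have cost : flip_cost r x = (Num.sqrt N%:R)^-1 * (2 / N%:R) * (2 * D + 2 * E) by [].
have Np : 0 < N%:R :> R by rewrite ltr0n.
have sp : 0 < (Num.sqrt N%:R)^-1 :> R by rewrite invr_gt0 sqrtr_gt0.
have W0 : 0 <= 2 * D + 2 * E.
  have D0 : 0 <= D by exact: sumr_ge0.
  have E0 : 0 <= E by apply: le_trans (bE _ _ u1 v1).
  lra.
have q1 : 1 <= #|S|%:R * (2 / N%:R) :> R.
  by rewrite mulrA ler_pdivlMr// mul1r mulrC -natrM ler_nat.
rewrite cost [X in _ < X -> _](_ : _ = (Num.sqrt N%:R)^-1 *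
  - (#|S|%:R * (2 / N%:R) * (2 * D + 2 * E))); last by ring.
rewrite ltr_pM2l//.
have := ler_wpM2r W0 q1.
by lra.
Qed.
End Flip.

Section Levels.
Context {R : realType} {k : nat}.
Local Notation N := k.*2.
Implicit Types (s : config N).
Hypothesis k0 : (0 < k)%N.

(** The distance from [count0 s] to [k]; one of the two truncated differences
vanishes. *)
Definition imbalance s : nat := ((count0 s - k) + (k - count0 s))%N.

Definition near_balanced (m : nat) : {set config N} := [set s | (imbalance s <= m)%N]%SET.

Lemma count0_flip s i :
  count0 (flip_at s i) = if s i == ord0 then (count0 s).-1 else (count0 s).+1.
Proof.
case: ifPn => [s0|s0].
  rewrite /count0 (cardsD1 i [set j | s j == _]) inE s0 /=; apply: eq_card => j.
  rewrite !inE ffunE; have [->|ji] //= := eqVneq j i.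
  by rewrite (eqP s0).
rewrite /count0 (cardsD1 i [set j | flip_at s i j == _]) inE ffunE eqxx.
rewrite ord2_add1_eq eq_sym s0 /= add1n; congr _.+1; apply: eq_card => j.
rewrite !inE ffunE; have [->|ji] //= := eqVneq j i.
by rewrite (negbTE s0).
Qed.

Lemma exists_flip_closer (r : R) x s : 0 < r -> (0 < imbalance s)%N ->
  exists i, ((imbalance (flip_at s i)).+1 == imbalance s) &&
    (hamiltonian (curried x) s <= hamiltonian (curried x) (flip_at s i) + flip_cost r x).
Proof.
move=> r0 bs; have N0 : (0 < N)%N by rewrite double_gt0.
have cN := count0_le s.
have [ks|sk] := ltnP k (count0 s).
  have [|i si hi] := @exists_cheap_flip R _ r x s ord0 N0 r0.
    by rewrite -/(count0 s); lia.
  exists i; rewrite hi andbT /imbalance count0_flip si eqxx; lia.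
have ks : (count0 s < k)%N by move: bs; rewrite /imbalance; lia.
have [|i si hi] := @exists_cheap_flip R _ r x s (lift ord0 ord0) N0 r0.
  by rewrite count1E; lia.
exists i; rewrite hi andbT /imbalance count0_flip si /=; lia.
Qed.

(** Flips towards balance are iterated, in the zero field. *)
Lemma exists_near_balanced m : exists s, s \in near_balanced m.
Proof.
suff h n s : (imbalance s <= m + n)%N -> exists s, s \in near_balanced m.
  pose s : config N := [ffun=> ord0].
  by apply: (h (imbalance s) s); lia.
elim: n s => [|n IH] s; first by rewrite addn0 => sm; exists s; rewrite inE.
rewrite addnS leq_eqVlt => /orP[/eqP sn|]; last exact: IH.
have [|i /andP[/eqP hi _]] := exists_flip_closer (fun=> 0 : R) (s := s) ltr01.
  by rewrite sn.
by apply: (IH (flip_at s i)); move: hi; rewrite sn; lia.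
Qed.

Definition rebalance (r : R) x m s : config N :=
  if (imbalance s <= m)%N then s else
  if [pick i | ((imbalance (flip_at s i)).+1 == imbalance s) &&
     (hamiltonian (curried x) s <= hamiltonian (curried x) (flip_at s i) + flip_cost r x)]
  is Some i then flip_at s i else s.

(** [rebalance] changes at most one site, so its fibers have at most [N + 1]
elements. *)
Lemma pressure_near_balancedS (beta : \bar R) (r : R) x m : (0 <= beta)%E -> 0 < r ->
  pressure beta (hamiltonian (curried x)) (near_balanced m.+1) <=
  pressure beta (hamiltonian (curried x)) (near_balanced m) +
  (ln N.+1%:R + weight beta * flip_cost r x).
Proof.
move=> b0 r0; have [s0 s0A] := exists_near_balanced m.+1.
rewrite addrA; apply: (pressure_le_map (r := rebalance r x m) b0 s0A).
- move=> s; rewrite !inE /rebalance; case: ifP => // /negbT sm sm1.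
  case: pickP => [i /andP[/eqP hi _]|none]; first by lia.
  have [|i] := exists_flip_closer x (s := s) r0; first by lia.
  by rewrite none.
- move=> s _; rewrite /rebalance; case: ifP => _; first by rewrite lerDl flip_cost_ge0.
  case: pickP => [i /andP[_ hi]|_] //; by rewrite lerDl flip_cost_ge0.
- move=> t _; apply: (@leq_trans #|t |: [set flip_at t i | i : 'I_N]|%SET).
    apply: subset_leq_card; apply/fintype.subsetP => s; rewrite !inE => /andP[_ /eqP <-].
    rewrite /rebalance; case: ifP => _; first by rewrite eqxx.
    case: pickP => [i _|_]; last by rewrite eqxx.
    by apply/orP; right; apply/imsetP; exists i => //; rewrite (flip_atK i s).
  rewrite cardsU1; apply: leq_trans (leq_add (leq_b1 _) (leq_imset_card _ _)) _.
  by rewrite card_ord.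
Qed.

Lemma pressure_near_balanced (beta : \bar R) (r : R) x m : (0 <= beta)%E -> 0 < r ->
  pressure beta (hamiltonian (curried x)) (near_balanced m) <=
  pressure beta (hamiltonian (curried x)) (near_balanced 0) +
  m%:R * (ln N.+1%:R + weight beta * flip_cost r x).
Proof.
move=> b0 r0; elim: m => [|m IH]; first by rewrite mul0r addr0.
apply: le_trans (pressure_near_balancedS x m b0 r0) _.
by rewrite -[m.+1]addn1 natrD mulrDl mul1r; move: IH; lra.
Qed.

Lemma near_balanced0 : near_balanced 0 = balanced (R := R).
Proof.
have N0 : (0 < N)%N by rewrite double_gt0.
apply/setP => s; rewrite !inE -subr_eq0 -normr_eq0 norm_magnetization//.
rewrite mulf_eq0 normr_eq0 invr_eq0 mulf_eq0 !pnatr_eq0 /= gtn_eqF// orbF.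
rewrite /spin_sum subr_eq0 -natrM eqr_nat /imbalance; lia.
Qed.

Lemma unbalancedC_sub m : (0 < m)%N ->
  (~: unbalanced (m%:R / N%:R : R))%SET \subset near_balanced m.
Proof.
move=> m0; have N0 : (0 < N)%N by rewrite double_gt0.
have Np : 0 < N%:R :> R by rewrite ltr0n.
apply/fintype.subsetP => s; rewrite !inE -ltNge norm_magnetization//.
rewrite ltr_pdivrMr ?mulr_gt0// mulrCA mulfVK ?gt_eqF// /spin_sum /imbalance.
rewrite ltr_norml => /andP[h1 h2].
have : (N < 2 * count0 s + 2 * m)%N by rewrite -(ltr_nat R) natrD !natrM; lra.
have : (2 * count0 s < N + 2 * m)%N by rewrite -(ltr_nat R) natrD !natrM; lra.
lia.
Qed.

End Levels.

Section GoodEvent.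
Context {R : realType} {N : nat}.
Implicit Types (g : 'I_N -> 'I_N -> R) (U : {set config N}).

(** If the complement of [U] carries more than half of the Gibbs mass, its
partition function is at least half of the total; at infinite [beta] it contains
a maximizer. *)
Lemma pressure_setC_ge (beta : \bar R) g U : (0 <= beta)%E -> gibbs beta g U < 2^-1 ->
  (exists s, s \in (~: U)%SET) /\
  pressure beta (hamiltonian g) [set: config N]%SET <=
  pressure beta (hamiltonian g) (~: U)%SET + ln 2.
Proof.
move=> b0 hU; have Utot := sum_gibbs_mass g b0.
have split_sum (F : config N -> R) : \sum_s F s = \sum_(s in U) F s + \sum_(s in (~: U)%SET) F s.
  rewrite (bigID (mem U)) /=; congr (_ + _).
  by apply: eq_bigl => s; rewrite inE.
rewrite split_sum -/(gibbs beta g U) -/(gibbs beta g (~: U)%SET) in Utot.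
have hC : 2^-1 < gibbs beta g (~: U)%SET by lra.
have [s0 s0C gs0] : exists2 s, s \in (~: U)%SET & 0 < gibbs_mass beta g s.
  apply: contrapT => nex; move: hC; rewrite ltNge => /negP; apply.
  rewrite /gibbs big1 ?invr_ge0// => s sC; apply/eqP.
  rewrite eq_le gibbs_mass_ge0 andbT leNgt; apply/negP => gs; apply: nex.
  by exists s.
split; first by exists s0.
case: beta b0 hU Utot hC gs0 => [b| |] //= b0 hU Utot hC gs0; last first.
  have [t [_ -> _]] := sup_finset (hamiltonian g) (finset.in_setT s0).
  have [u [_ -> umax]] := sup_finset (hamiltonian g) s0C.
  have s0m : s0 \in maximizers g.
    by move: gs0; case: (s0 \in _) => //; rewrite mul0r ltxx.
  have : hamiltonian g t <= hamiltonian g s0.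
    by move: s0m; rewrite inE => /forallP.
  have := umax _ s0C; have : 0 <= ln 2 :> R by rewrite ln_ge0// ler1n.
  by lra.
have Zp := partition_function_gt0 b g (finset.in_setT s0).
have Cp := partition_function_gt0 b g s0C.
move: hC; rewrite /gibbs /= -mulr_suml ltr_pdivlMr//.
rewrite -!/(partition_function b g _) => hC.
rewrite -lnM ?posrE// ler_ln ?posrE ?mulr_gt0//; lra.
Qed.

End GoodEvent.

(** * The cost of the balance constraint *)

Section PressureMean.
Context {R : realType} {N : nat}.
Local Notation pairs := ('I_N * 'I_N)%type.
Variable mu : probability (field_space R pairs) R.
Hypothesis gmu : gaussian_field mu.
Local Notation H x := (hamiltonian (curried x)).
Local Notation kappa := (1 + @fourth_moment R).

Lemma hamiltonian_norm_le (x : field_space R pairs) s :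
  `|H x s| <= (Num.sqrt N%:R)^-1 * norm1 x.
Proof.
rewrite /hamiltonian normrM ger0_norm ?invr_ge0 ?sqrtr_ge0//.
rewrite ler_wpM2l ?invr_ge0 ?sqrtr_ge0// pair_bigA /=.
apply: le_trans (ler_norm_sum _ _ _) _; apply: ler_sum => -[i j] _ /=.
by rewrite normrM ler_piMr//; case: eqP => _; rewrite ?normr1 ?normr0.
Qed.

(** A bound on the pressure of any nonempty set of configurations, obtained from
the largest energy and the number of configurations. *)
Definition pressure_bound (beta : \bar R) (x : field_space R pairs) : R :=
  N%:R + weight beta * ((Num.sqrt N%:R)^-1 * norm1 x).

Lemma ln_card_config : ln #|config N|%:R <= N%:R :> R.
Proof.
rewrite card_ffun !card_ord natrX lnXn// -[leLHS]mulr_natl ler_piMr//.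
have := @le_ln1Dx R 1; rewrite (_ : 1 + 1 = 2)//; apply; lra.
Qed.

Lemma pressure_le_bound (beta : \bar R) (A : {set config N}) s0 x :
  (0 <= beta)%E -> s0 \in A -> `|pressure beta (H x) A| <= pressure_bound beta x.
Proof.
move=> b0 s0A; apply: le_trans (pressure_norm_le b0 s0A (hamiltonian_norm_le x)) _.
by rewrite lerD2r ln_card_config.
Qed.

Lemma integrable_pressure_bound beta : mu.-integrable setT (EFin \o pressure_bound beta).
Proof.
apply: integrable_addR; first exact: finite_measure_integrable_cst.
by do 2 apply: integrable_mulR; exact: integrable_norm1.
Qed.

Lemma integrable_pressure (beta : \bar R) (A : {set config N}) s0 :
  (0 <= beta)%E -> s0 \in A ->
  mu.-integrable setT (EFin \o (fun x => pressure beta (H x) A)).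
Proof.
move=> b0 s0A; apply: (le_integrable measurableT _ _ (integrable_pressure_bound beta)).
  apply/measurable_EFinP; apply: (measurable_pressure _ s0A) => s.
  exact: measurable_hamiltonian.
move=> x _ /=; rewrite lee_fin (le_trans (pressure_le_bound _ b0 s0A))//.
exact: ler_norm.
Qed.

Definition mean_pressure (beta : \bar R) (A : {set config N}) : R :=
  \int[mu]_x pressure beta (H x) A.

Lemma expectation_pressure_bound beta : (0 <= beta)%E ->
  \int[mu]_x pressure_bound beta x <=
  N%:R + weight beta * ((Num.sqrt N%:R)^-1 * (N%:R ^+ 2 * kappa)).
Proof.
move=> b0; rewrite RintegralD//; [|exact: finite_measure_integrable_cst|]; last first.
  by do 2 apply: integrable_mulR; exact: integrable_norm1.
rewrite Rintegral_probability_cst lerD2l RintegralZl//; last first.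
  by apply: integrable_mulR; exact: integrable_norm1.
rewrite ler_wpM2l ?weight_ge0// RintegralZl//; last exact: integrable_norm1.
rewrite ler_wpM2l ?invr_ge0 ?sqrtr_ge0//.
by apply: le_trans (expectation_norm1 gmu) _; rewrite card_prod card_ord natrM expr2.
Qed.

Lemma mean_pressure_norm_le beta (A : {set config N}) s0 : (0 <= beta)%E -> s0 \in A ->
  `|mean_pressure beta A| <=
  N%:R + weight beta * ((Num.sqrt N%:R)^-1 * (N%:R ^+ 2 * kappa)).
Proof.
move=> b0 s0A; apply: le_trans _ (expectation_pressure_bound b0).
have iP := integrable_pressure b0 s0A.
apply: le_trans (le_normr_Rintegral _ iP) _ => //.
apply: le_Rintegral => //; first exact: (integrable_norm iP).
- exact: integrable_pressure_bound.
- by move=> x _; exact: pressure_le_bound s0A.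
Qed.

Lemma integrable_sqr_pressure_bound beta :
  mu.-integrable setT (EFin \o (fun x => pressure_bound beta x ^+ 2)).
Proof.
have -> : (fun x => pressure_bound beta x ^+ 2) = (fun x => N%:R ^+ 2 +
   (2 * N%:R * (weight beta * (Num.sqrt N%:R)^-1) * norm1 x +
    (weight beta * (Num.sqrt N%:R)^-1) ^+ 2 * norm1 x ^+ 2)).
  by apply/funext => x; rewrite /pressure_bound; ring.
apply: integrable_addR; first exact: finite_measure_integrable_cst.
apply: integrable_addR; apply: integrable_mulR; first exact: integrable_norm1.
exact: integrable_sqr_norm1.
Qed.

Lemma expectation_sqr_pressure_bound beta : (0 < N)%N ->
  \int[mu]_x pressure_bound beta x ^+ 2 <=
  2 * N%:R ^+ 2 + 2 * weight beta ^+ 2 * N%:R ^+ 3 * kappa.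
Proof.
move=> N0; have Np : 0 < N%:R :> R by rewrite ltr0n.
pose c := 2 * weight beta ^+ 2 / N%:R : R.
have ic : mu.-integrable setT (EFin \o (fun x => c * norm1 x ^+ 2)).
  by apply: integrable_mulR; exact: integrable_sqr_norm1.
apply: (@le_trans _ _ (\int[mu]_x (2 * N%:R ^+ 2 + c * norm1 x ^+ 2))).
  apply: le_Rintegral => //; first exact: integrable_sqr_pressure_bound.
    by apply: integrable_addR => //; exact: finite_measure_integrable_cst.
  move=> x _; rewrite /pressure_bound.
  have -> : c * norm1 x ^+ 2 = 2 * (weight beta * ((Num.sqrt N%:R)^-1 * norm1 x)) ^+ 2.
    by rewrite !exprMn exprVn sqr_sqrtr// /c; ring.
  set u := weight _ * _; have := sqr_ge0 (N%:R - u); nra.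
rewrite RintegralD//; last exact: finite_measure_integrable_cst.
rewrite Rintegral_probability_cst lerD2l RintegralZl//; last exact: integrable_sqr_norm1.
have c0 : 0 <= c by apply: divr_ge0; [apply: mulr_ge0; [|exact: sqr_ge0]|].
apply: le_trans (ler_wpM2l c0 (expectation_sqr_norm1 gmu)) _.
rewrite card_prod card_ord natrM /c le_eqVlt; apply/orP; left; apply/eqP.
by field; rewrite gt_eqF.
Qed.

End PressureMean.

Section FlipCostMean.
Context {R : realType} {N : nat}.
Local Notation pairs := ('I_N * 'I_N)%type.
Variable mu : probability (field_space R pairs) R.
Hypothesis gmu : gaussian_field mu.
Local Notation kappa := (1 + @fourth_moment R).

(** A bound on the mean of [flip_cost]: the means of the diagonal sum and of
[gram] are replaced by their bounds. *)
Definition flip_cost_mean (r : R) : R :=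
  (Num.sqrt N%:R)^-1 * (2 / N%:R) *
  (2 * (N%:R * kappa) + 2 * (r + N%:R ^+ 4 * (2 * N%:R ^+ 3 * kappa) / r ^+ 3)).

Let costE (r : R) : (fun x => flip_cost r x) = (fun x : field_space R pairs =>
  (Num.sqrt N%:R)^-1 * (2 / N%:R) * (2 * (\sum_i `|x (i, i)|) +
   (2 * r + 2 * N%:R ^+ 4 / r ^+ 3 * gram x))).
Proof. by apply/funext => x; rewrite /flip_cost; congr (_ * (_ + _)); ring. Qed.

Let i1 : mu.-integrable setT (EFin \o (fun x => \sum_i `|x (i, i)|)).
Proof. by apply: integrable_sumR => i _; exact: integrable_norm_coord. Qed.

Lemma integrable_flip_cost (r : R) :
  mu.-integrable setT (EFin \o (fun x => flip_cost r x)).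
Proof.
rewrite costE; apply: integrable_mulR; apply: integrable_addR.
  exact: integrable_mulR.
apply: integrable_addR; first exact: finite_measure_integrable_cst.
by apply: integrable_mulR; exact: integrable_gram.
Qed.

Lemma expectation_flip_cost (r : R) : 0 < r ->
  \int[mu]_x flip_cost r x <= flip_cost_mean r.
Proof.
move=> r0; have i2 := integrable_gram gmu.
have i3 : mu.-integrable setT
    (EFin \o (fun x => 2 * r + 2 * N%:R ^+ 4 / r ^+ 3 * gram x)).
  by apply: integrable_addR; [exact: finite_measure_integrable_cst|exact: integrable_mulR].
have i4 := integrable_mulR 2 i1.
rewrite (costE r) RintegralZl//; last exact: integrable_addR.
apply: ler_wpM2l.
  by rewrite mulr_ge0 ?invr_ge0 ?sqrtr_ge0// divr_ge0.
rewrite RintegralD// RintegralZl//.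
rewrite RintegralD//; [|exact: finite_measure_integrable_cst|exact: integrable_mulR].
rewrite Rintegral_probability_cst RintegralZl//.
have e1 : \int[mu]_x (\sum_i `|x (i, i)|) <= N%:R * kappa.
  rewrite Rintegral_sum; last by move=> i _; exact: integrable_norm_coord.
  apply: (@le_trans _ _ (\sum_(i < N) kappa)).
    by apply: ler_sum => i _; exact: expectation_norm_coord.
  by rewrite sumr_const card_ord mulr_natl.
have e2 : \int[mu]_x gram x <= 2 * N%:R ^+ 3 * kappa.
  apply: le_trans (expectation_gram gmu) _; rewrite ler_wpM2l ?mulr_ge0 ?exprn_ge0//.
  by lra.
have c0 : 0 <= 2 * N%:R ^+ 4 / r ^+ 3.
  by rewrite divr_ge0 ?mulr_ge0 ?exprn_ge0// ltW.
have := ler_wpM2l c0 e2; have -> : 2 * (r + N%:R ^+ 4 * (2 * N%:R ^+ 3 * kappa) / r ^+ 3) =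
   2 * r + 2 * N%:R ^+ 4 / r ^+ 3 * (2 * N%:R ^+ 3 * kappa) by ring.
by lra.
Qed.

End FlipCostMean.

Section BalancedGap.
Context {R : realType} {k : nat}.
Local Notation N := k.*2.
Local Notation pairs := ('I_N * 'I_N)%type.
Variable mu : probability (field_space R pairs) R.
Hypothesis gmu : gaussian_field mu.
Hypothesis k0 : (0 < k)%N.
Local Notation H x := (hamiltonian (curried x)).
Local Notation kappa := (1 + @fourth_moment R).

(** If [G], the Gibbs mass of the unbalanced set, is below 1/2, the chain of
rebalancing flips applies.  Otherwise the difference is at most
[2 * pressure_bound], which the two last terms absorb by the inequality of
arithmetic and geometric means, [t * G] being at least [t / 2].  The energy and
[G] thus enter separately, although they are strongly dependent. *)
Lemma pressure_gap_le (beta : \bar R) (m : nat) (r t : R) (x : field_space R pairs) :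
  (0 <= beta)%E -> (0 < m)%N -> 0 < r -> 0 < t ->
  pressure beta (H x) [set: config N]%SET <=
  pressure beta (H x) (balanced (R := R)) +
  (ln 2 + m%:R * ln N.+1%:R + (m%:R * weight beta) * flip_cost r x +
   4 / t * pressure_bound beta x ^+ 2 +
   t * gibbs beta (curried x) (unbalanced (m%:R / N%:R : R))).
Proof.
move=> b0 m0 r0 t0; set U := unbalanced _; set G := gibbs _ _ _.
have G0 : 0 <= G by apply: sumr_ge0 => s _; exact: gibbs_mass_ge0.
have l2 : 0 <= ln 2 :> R by rewrite ln_ge0// ler1n.
have lN : 0 <= ln N.+1%:R :> R by rewrite ln_ge0// ler1n.
have w0 := weight_ge0 b0.
have c0 := flip_cost_ge0 x r0.
have mc0 : 0 <= m%:R * weight beta * flip_cost r x.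
  by apply: mulr_ge0 => //; apply: mulr_ge0.
have ml0 : 0 <= m%:R * ln N.+1%:R :> R by rewrite mulr_ge0.
have [s0 s0B] := exists_near_balanced (R := R) k0 0.
have s0B' : s0 \in balanced (R := R) by rewrite -(near_balanced0 k0).
have pb0 : 0 <= pressure_bound beta x.
  by rewrite addr_ge0// !mulr_ge0 ?invr_ge0 ?sqrtr_ge0 ?norm1_ge0.
have p20 : 0 <= 4 / t * pressure_bound beta x ^+ 2.
  by rewrite mulr_ge0 ?sqr_ge0// divr_ge0// ltW.
have tG0 : 0 <= t * G by rewrite mulr_ge0// ltW.
have [Gbig|Gsmall] := leP (2^-1) G.
  have h1 := pressure_le_bound x b0 (finset.in_setT s0).
  have h2 := pressure_le_bound x b0 s0B'.
  move: h1 h2; rewrite !ler_norml => /andP[_ h1] /andP[h2 _].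
  have tG : t / 2 <= t * G by rewrite ler_wpM2l// ltW.
  have : 2 * pressure_bound beta x <= 4 / t * pressure_bound beta x ^+ 2 + t / 2.
    rewrite -subr_ge0; have -> : 4 / t * pressure_bound beta x ^+ 2 + t / 2 -
       2 * pressure_bound beta x =
      ((2 * pressure_bound beta x - t / 2) ^+ 2 + t ^+ 2 / 4) / t.
      by field; rewrite gt_eqF.
    by rewrite divr_ge0 ?addr_ge0 ?divr_ge0 ?sqr_ge0// ltW.
  by lra.
have [[s1 s1C] hC] := pressure_setC_ge b0 Gsmall.
have h3 := pressure_sub (H x) b0 s1C (unbalancedC_sub (R := R) k0 m0).
have h4 := pressure_near_balanced k0 x m b0 r0.
rewrite (near_balanced0 (R := R) k0) mulrDr mulrA in h4.
by lra.
Qed.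

Lemma mean_pressure_gap_le (beta : \bar R) (m : nat) (r t : R) :
  (0 <= beta)%E -> (0 < m)%N -> 0 < r -> 0 < t ->
  mean_pressure mu beta [set: config N]%SET <=
  mean_pressure mu beta (balanced (R := R)) +
  (ln 2 + m%:R * ln N.+1%:R + (m%:R * weight beta) * @flip_cost_mean R N r +
   4 / t * (2 * N%:R ^+ 2 + 2 * weight beta ^+ 2 * N%:R ^+ 3 * kappa) +
   t * (2 * expR (- ((m%:R / N%:R) ^+ 2 * N%:R)))).
Proof.
move=> b0 m0 r0 t0; have N0 : (0 < N)%N by rewrite double_gt0.
have w0 := weight_ge0 b0.
have [s0 s0B] := exists_near_balanced (R := R) k0 0.
have s0B' : s0 \in balanced (R := R) by rewrite -(near_balanced0 k0).
have j0 := integrable_pressure gmu b0 (finset.in_setT s0).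
have j1 := integrable_pressure gmu b0 s0B'.
have j2 := integrable_mulR (m%:R * weight beta) (integrable_flip_cost gmu r).
have j3 := integrable_mulR (4 / t) (integrable_sqr_pressure_bound gmu beta).
have j4 := integrable_mulR t (integrable_gibbs gmu (unbalanced (m%:R / N%:R : R)) b0).
have j5 := finite_measure_integrable_cst mu (ln 2 + m%:R * ln N.+1%:R) measurableT.
have j6 := integrable_addR j5 j2.
have j7 := integrable_addR j6 j3.
have j8 := integrable_addR j7 j4.
have j9 := integrable_addR j1 j8.
apply: (@le_trans _ _ (\int[mu]_x (pressure beta (H x) (balanced (R := R)) +
  (ln 2 + m%:R * ln N.+1%:R + (m%:R * weight beta) * flip_cost r x +
   4 / t * pressure_bound beta x ^+ 2 +
   t * gibbs beta (curried x) (unbalanced (m%:R / N%:R : R)))))).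
  by apply: le_Rintegral => // x _; exact: pressure_gap_le.
rewrite RintegralD// lerD2l RintegralD// RintegralD// RintegralD// Rintegral_probability_cst.
have zl (c : R) (f : field_space R pairs -> R) : mu.-integrable setT (EFin \o f) ->
    \int[mu]_x (c * f x) = c * \int[mu]_x f x by exact: RintegralZl.
rewrite (zl _ _ (integrable_flip_cost gmu r)) (zl _ _ (integrable_sqr_pressure_bound gmu beta)).
rewrite (zl _ _ (integrable_gibbs gmu _ b0)).
apply: lerD; [apply: lerD; [rewrite lerD2l|]|]; apply: ler_wpM2l.
- by rewrite mulr_ge0.
- exact: expectation_flip_cost.
- by rewrite divr_ge0// ltW.
- exact: expectation_sqr_pressure_bound.
- exact: ltW.
- by apply: expectation_gibbs_unbalanced => //; rewrite divr_gt0// ltr0n.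
Qed.

End BalancedGap.

Section GapAsymptotics.
Context {R : realType} {k : nat}.
Local Notation N := k.*2.
Local Notation pairs := ('I_N * 'I_N)%type.
Variable mu : probability (field_space R pairs) R.
Hypothesis gmu : gaussian_field mu.
Hypothesis k0 : (0 < k)%N.
Local Notation kappa := (1 + @fourth_moment R).

Definition gap_constant (w : R) : R := 83 + 32 * w * kappa + 8 * w ^+ 2 * kappa.

(** Exponents are expressed with [y = N^(1/12)]: the number [m] of flips is about
[y^8], large enough for [exp (- m^2 / N)] to beat any power, and [r = y^21],
which is [N^(7/4)], balances the two terms of [flip_cost_mean], of order [y^3].
With [t = y^25] the exceptional event costs [O(y^11)]. *)
Lemma mean_pressure_gap_asymptotics (beta : \bar R) (y : R) :
  (0 <= beta)%E -> 1 <= y -> y ^+ 12 = N%:R ->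
  mean_pressure mu beta [set: config N]%SET <=
  mean_pressure mu beta (balanced (R := R)) + gap_constant (weight beta) * y ^+ 11.
Proof.
move=> b0 y1 yN; have y0 : 0 < y by lra.
have yp n : 0 < y ^+ n by rewrite exprn_gt0.
have yge1 n : 1 <= y ^+ n by rewrite exprn_ege1.
have yle a b : (a <= b)%N -> y ^+ a <= y ^+ b by move=> ab; rewrite ler_weXn2l.
have yn0 : y != 0 by rewrite gt_eqF.
pose m := (Num.truncn (y ^+ 8)).+1.
have mlo : y ^+ 8 <= m%:R by rewrite ltW// truncnS_gt.
have mhi : m%:R <= 2 * y ^+ 8.
  rewrite /m -natr1; have := truncn_le (y ^+ 8); rewrite (ltW (yp _)) => h.
  have := yge1 8%N; lra.
have w0 := weight_ge0 b0; set w := weight beta in w0 *.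
have m4 := @fourth_moment_ge0 R.
have kap1 : 1 <= kappa by lra.
apply: le_trans (mean_pressure_gap_le gmu k0 b0 (ltn0Sn _ : (0 < m)%N) (yp 21%N) (yp 25%N)) _.
rewrite lerD2l -yN -/w.
have sqrtN : Num.sqrt N%:R = y ^+ 6 :> R.
  by rewrite -yN (_ : 12 = 6 * 2)%N// exprM sqrtr_sqr ger0_norm// ltW.
have t1 : ln 2 <= y ^+ 11 :> R.
  apply: le_trans (yge1 _); have := @le_ln1Dx R 1; rewrite (_ : 1 + 1 = 2)//.
  by apply; lra.
have t2 : m%:R * ln N.+1%:R <= 26 * y ^+ 11.
  have lnN : ln N.+1%:R <= 13 * y.
    apply: (@le_trans _ _ (ln (2 * y ^+ 12))).
      rewrite ler_ln ?posrE ?mulr_gt0// -natr1 -yN; have := yge1 12%N; lra.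
    rewrite lnM ?posrE// lnXn// -[ln y *+ 12]mulr_natl.
    have := ln_sublinear y0; have := @ln_sublinear R 1.
    have := @le_ln1Dx R 1; rewrite (_ : 1 + 1 = 2)// => /(_ ltac:(lra)).
    by lra.
  have ln0 : 0 <= ln N.+1%:R :> R by rewrite ln_ge0// ler1n.
  apply: (@le_trans _ _ (2 * y ^+ 8 * (13 * y))); first exact: ler_pM.
  have -> : 2 * y ^+ 8 * (13 * y) = 26 * y ^+ 9 by ring.
  by rewrite ler_pM2l// yle.
have t3 : m%:R * w * @flip_cost_mean R N (y ^+ 21) <= 32 * w * kappa * y ^+ 11.
  have fc : @flip_cost_mean R N (y ^+ 21) <= 16 * kappa * y ^+ 3.
    rewrite /flip_cost_mean sqrtN -yN.
    have -> : (y ^+ 6)^-1 * (2 / y ^+ 12) * (2 * (y ^+ 12 * kappa) + 2 * (y ^+ 21 +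
      (y ^+ 12) ^+ 4 * (2 * (y ^+ 12) ^+ 3 * kappa) / (y ^+ 21) ^+ 3)) =
      4 * kappa / y ^+ 6 + 4 * y ^+ 3 + 8 * kappa * y ^+ 3.
      by field.
    have : 4 * kappa / y ^+ 6 <= 4 * kappa * y ^+ 3.
      apply: ler_wpM2l; first lra.
      by rewrite (le_trans _ (yge1 3%N))// invf_le1.
    have : y ^+ 3 <= kappa * y ^+ 3 by rewrite ler_peMl// ltW.
    lra.
  have w2 : 0 <= 16 * kappa * y ^+ 3 by apply: mulr_ge0; [lra|exact: ltW].
  apply: (@le_trans _ _ (m%:R * w * (16 * kappa * y ^+ 3))).
    by rewrite ler_wpM2l// mulr_ge0.
  apply: (@le_trans _ _ (2 * y ^+ 8 * w * (16 * kappa * y ^+ 3))).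
    by rewrite ler_wpM2r// ler_wpM2r.
  by rewrite le_eqVlt; apply/orP; left; apply/eqP; ring.
have t4 : 4 / y ^+ 25 * (2 * (y ^+ 12) ^+ 2 + 2 * w ^+ 2 * (y ^+ 12) ^+ 3 * kappa) <=
    8 * y ^+ 11 + 8 * w ^+ 2 * kappa * y ^+ 11.
  have -> : 4 / y ^+ 25 * (2 * (y ^+ 12) ^+ 2 + 2 * w ^+ 2 * (y ^+ 12) ^+ 3 * kappa) =
    8 / y + 8 * w ^+ 2 * kappa * y ^+ 11 by field.
  rewrite lerD2r ler_pM2l//; apply: le_trans (yge1 _).
  by rewrite invf_le1.
have t5 : y ^+ 25 * (2 * expR (- ((m%:R / y ^+ 12) ^+ 2 * y ^+ 12))) <= 48 * y ^+ 11.
  have mN : y ^+ 4 <= (m%:R / y ^+ 12) ^+ 2 * y ^+ 12.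
    have -> : (m%:R / y ^+ 12) ^+ 2 * y ^+ 12 = m%:R ^+ 2 / y ^+ 12 by field.
    rewrite ler_pdivlMr// -exprD (_ : 4 + 12 = 8 * 2)%N// exprM.
    by rewrite lerXn2r ?nnegrE// ltW.
  have e4 : expR (- ((m%:R / y ^+ 12) ^+ 2 * y ^+ 12)) <= 24 / y ^+ 16.
    apply: (@le_trans _ _ (expR (- y ^+ 4))); first by rewrite ler_expR lerN2.
    rewrite expRN -[24 / _]invrK lef_pV2 ?posrE ?expR_gt0 ?invr_gt0 ?divr_gt0//.
    have := @expR_ge1Dxn R (y ^+ 4) 3 (ltW (yp _)).
    rewrite (_ : 4`! = 24)%N// invf_div -exprM; lra.
  apply: (@le_trans _ _ (y ^+ 25 * (2 * (24 / y ^+ 16)))).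
    by rewrite ler_pM2l// ler_pM2l.
  have -> : y ^+ 25 * (2 * (24 / y ^+ 16)) = 48 * y ^+ 9 by field.
  by rewrite ler_pM2l// yle.
rewrite /gap_constant.
by lra.
Qed.

End GapAsymptotics.

(** * Adding one site *)

Section OneMoreSite.
Context {R : realType} {N : nat}.
Hypothesis N0 : (0 < N)%N.
Local Notation pairs n := ('I_n * 'I_n)%type.
Local Notation kappa := (1 + @fourth_moment R).
Implicit Types (x : field_space R (pairs N.+1)).

Definition widenS (i : 'I_N) : 'I_N.+1 := widen_ord (leqnSn N) i.

Definition corner (p : pairs N) : pairs N.+1 := (widenS p.1, widenS p.2).

Definition restrict (s : config N.+1) : config N := [ffun i => s (widenS i)].

Definition extend (t : config N) : config N.+1 :=
  [ffun i => if insub (val i) is Some j then t j else ord0].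

Lemma corner_inj : injective corner.
Proof. by move=> [i j] [i' j'] [] /val_inj -> /val_inj ->. Qed.

Lemma extendK : cancel extend restrict.
Proof.
move=> t; apply/ffunP => i; rewrite !ffunE.
case: insubP => [j _ ji|/negP[]]; last exact: (ltn_ord i).
by congr (t _); exact/val_inj.
Qed.

Lemma card_restrict_fiber (A : {set config N.+1}) t :
  (#|[set s in A | restrict s == t]%SET| <= 2)%N.
Proof.
rewrite -(card_in_imset (f := fun s : config N.+1 => s ord_max)).
  by apply: leq_trans (max_card _) _; rewrite card_ord.
move=> s s'; rewrite !inE => /andP[_ /eqP rs] /andP[_ /eqP rs'] ss'.
apply/ffunP => i; have [iN|Ni] := ltnP i N; last first.
  suff -> : i = ord_max by [].
  by apply/val_inj => /=; have := ltn_ord i; lia.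
have -> : i = widenS (Ordinal iN) by exact/val_inj.
by move/ffunP: rs => /(_ (Ordinal iN)); move/ffunP: rs' => /(_ (Ordinal iN));
  rewrite !ffunE => -> ->.
Qed.

Definition new_site_norm x : R :=
  \sum_i `|x (widenS i, ord_max)| + \sum_j `|x (ord_max, j)|.

Definition site_error x : R :=
  (Num.sqrt N%:R)^-1 * (N%:R^-1 * norm1 (x \o corner) + new_site_norm x).

(** The effect of the change of normalization from N to N + 1 sites. *)
Lemma inv_sqrtS_le : 0 <= (Num.sqrt (N%:R : R))^-1 - (Num.sqrt N.+1%:R)^-1 <=
  (Num.sqrt N%:R)^-1 * N%:R^-1.
Proof.
have Np : 0 < N%:R :> R by rewrite ltr0n.
set a := Num.sqrt N%:R; set b := Num.sqrt N.+1%:R.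
have a0 : 0 < a by rewrite sqrtr_gt0.
have b0 : 0 < b by rewrite sqrtr_gt0 ltr0n.
have aa : a ^+ 2 = N%:R by rewrite sqr_sqrtr// ltW.
have bb : b ^+ 2 = N%:R + 1 by rewrite sqr_sqrtr// natr1.
have ab : a <= b by rewrite ler_sqrt ?ltr0n// ler_nat.
have -> : a^-1 - b^-1 = (b - a) / (a * b) by field; rewrite !gt_eqF.
rewrite divr_ge0 ?mulr_ge0 ?subr_ge0 ?(ltW a0) ?(ltW b0)//=.
rewrite -aa -invfM ler_pdivrMr ?mulr_gt0// mulrC ler_pdivlMr ?mulr_gt0 ?exprn_gt0//.
have ba1 : (b - a) * a <= 1 by nra.
have : (b - a) * a * a ^+ 2 <= a ^+ 2 by rewrite ler_piMl ?sqr_ge0.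
nra.
Qed.

(** The energy of the first N sites is renormalized, and the pairs that involve
the new site are bounded by the absolute values of their couplings. *)
Lemma hamiltonian_restrict_le x s :
  `|hamiltonian (curried x) s - hamiltonian (curried (x \o corner)) (restrict s)|
  <= site_error x.
Proof.
pose A := \sum_i \sum_j x (widenS i, widenS j) * (s (widenS i) == s (widenS j))%:R.
pose B := \sum_i x (widenS i, ord_max) * (s (widenS i) == s ord_max)%:R +
          \sum_j x (ord_max, j) * (s ord_max == s j)%:R.
have HN : hamiltonian (curried (x \o corner)) (restrict s) = (Num.sqrt N%:R)^-1 * A.
  congr (_ * _); apply: eq_bigr => i _; apply: eq_bigr => j _.
  by rewrite !ffunE.
have HS : hamiltonian (curried x) s = (Num.sqrt N.+1%:R)^-1 * (A + B).
  congr (_ * _); rewrite big_ord_recr /= /B addrA; congr (_ + _).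
  rewrite -big_split /=; apply: eq_bigr => i _; rewrite big_ord_recr /=.
  by [].
have term_le (y : R) (b : bool) : `|y * b%:R| <= `|y|.
  by rewrite normrM ler_piMr//; case: b; rewrite ?normr1 ?normr0.
have An : `|A| <= norm1 (x \o corner).
  rewrite /A pair_bigA /=; apply: le_trans (ler_norm_sum _ _ _) _.
  by apply: ler_sum => -[i j] _ /=; exact: term_le.
have Bn : `|B| <= new_site_norm x.
  apply: le_trans (ler_normD _ _) _; apply: lerD;
    by apply: le_trans (ler_norm_sum _ _ _) _; apply: ler_sum => i _; exact: term_le.
rewrite HN HS /site_error.
have := inv_sqrtS_le; set a := (Num.sqrt N%:R)^-1; set b := (Num.sqrt N.+1%:R)^-1.
move=> /andP[h1 h2].
have b0 : 0 <= b by rewrite invr_ge0 sqrtr_ge0.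
have -> : b * (A + B) - a * A = - ((a - b) * A) + b * B by ring.
apply: le_trans (ler_normD _ _) _; rewrite normrN !normrM (ger0_norm h1) (ger0_norm b0).
rewrite mulrDr mulrA; apply: lerD; apply: ler_pM => //; lra.
Qed.

(** Restriction has fibers of size 2 and extension is injective, so comparison
applies in both directions. *)
Lemma pressure_restrict_le (beta : \bar R) x : (0 <= beta)%E ->
  `|pressure beta (hamiltonian (curried x)) [set: config N.+1]%SET -
    pressure beta (hamiltonian (curried (x \o corner))) [set: config N]%SET|
  <= ln 2 + weight beta * site_error x.
Proof.
move=> b0; have hh s := hamiltonian_restrict_le x s.
have l2 : 0 <= ln 2 :> R by rewrite ln_ge0// ler1n.
pose s0 : config N.+1 := [ffun=> ord0].
have up : pressure beta (hamiltonian (curried x)) [set: config N.+1]%SET <=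
    pressure beta (hamiltonian (curried (x \o corner))) [set: config N]%SET +
    ln 2%:R + weight beta * site_error x.
  apply: (pressure_le_map (r := restrict) b0 (finset.in_setT s0)).
  - by move=> s _; rewrite finset.in_setT.
  - by move=> s _; have := hh s; rewrite ler_norml => /andP[_]; lra.
  - by move=> t _; exact: card_restrict_fiber.
have lo : pressure beta (hamiltonian (curried (x \o corner))) [set: config N]%SET <=
    pressure beta (hamiltonian (curried x)) [set: config N.+1]%SET +
    ln 1%:R + weight beta * site_error x.
  apply: (pressure_le_map (r := extend) b0 (finset.in_setT (restrict s0))).
  - by move=> s _; rewrite finset.in_setT.
  - by move=> t _; have := hh (extend t); rewrite extendK ler_norml => /andP[]; lra.
  - move=> s _; apply: (@leq_trans #|[set restrict s]%SET|); last by rewrite cards1.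
    apply: subset_leq_card.
    by apply/fintype.subsetP => t; rewrite !inE => /eqP <-; rewrite extendK.
rewrite ler_distl lerBlDr !addrA up andbT; apply: le_trans lo _.
by rewrite ln1 addr0 lerD2r lerDl.
Qed.

Variables (mu : probability (field_space R (pairs N)) R)
          (nu : probability (field_space R (pairs N.+1)) R).
Hypotheses (gmu : gaussian_field mu) (gnu : gaussian_field nu).

Lemma integrable_new_site_norm : nu.-integrable setT (EFin \o new_site_norm).
Proof.
by apply: integrable_addR; apply: integrable_sumR => i _; exact: integrable_norm_coord.
Qed.

Lemma integrable_norm1_corner :
  nu.-integrable setT (EFin \o (fun x => norm1 (x \o corner))).
Proof. by apply: integrable_sumR => i _; exact: integrable_norm_coord. Qed.

Lemma integrable_site_error : nu.-integrable setT (EFin \o site_error).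
Proof.
apply: integrable_mulR; apply: integrable_addR; last exact: integrable_new_site_norm.
by apply: integrable_mulR; exact: integrable_norm1_corner.
Qed.

Lemma expectation_site_error :
  \int[nu]_x site_error x <= 4 * Num.sqrt N%:R * kappa.
Proof.
have Np : 0 < N%:R :> R by rewrite ltr0n.
have zl (c : R) (f : field_space R (pairs N.+1) -> R) :
    nu.-integrable setT (EFin \o f) ->
    \int[nu]_x (c * f x) = c * \int[nu]_x f x by exact: RintegralZl.
have i1 := integrable_norm1_corner; have i2 := integrable_new_site_norm.
have i3 := integrable_mulR N%:R^-1 i1; have i4 := integrable_addR i3 i2.
have sumk n : \sum_(i < n) kappa = n%:R * kappa.
  by rewrite sumr_const card_ord mulr_natl.
have e1 : \int[nu]_x norm1 (x \o corner) <= N%:R ^+ 2 * kappa.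
  rewrite Rintegral_sum; last by move=> i _; exact: integrable_norm_coord.
  apply: (@le_trans _ _ (\sum_(p : pairs N) kappa)).
    by apply: ler_sum => p _; exact: expectation_norm_coord.
  by rewrite sumr_const card_prod card_ord -[leLHS]mulr_natl natrM expr2.
have e2 : \int[nu]_x new_site_norm x <= N%:R * kappa + N.+1%:R * kappa.
  rewrite RintegralD//; try by apply: integrable_sumR => i _; exact: integrable_norm_coord.
  rewrite !Rintegral_sum; try by move=> i _; exact: integrable_norm_coord.
  by rewrite -!sumk; apply: lerD; apply: ler_sum => i _; exact: expectation_norm_coord.
rewrite /site_error zl// RintegralD// zl//.
have -> : 4 * Num.sqrt N%:R * kappa = (Num.sqrt N%:R)^-1 * (4 * N%:R * kappa).
  rewrite -{3}(sqr_sqrtr (ltW Np)); field; rewrite gt_eqF// sqrtr_gt0//.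
apply: ler_wpM2l; first by rewrite invr_ge0 sqrtr_ge0.
have k1 : 1 <= kappa by have := @fourth_moment_ge0 R; lra.
have : N%:R^-1 * \int[nu]_x norm1 (x \o corner) <= N%:R * kappa.
  rewrite mulrC ler_pdivrMr//; apply: le_trans e1 _; rewrite expr2; lra.
have N1 : 1 <= N%:R :> R by rewrite ler1n.
rewrite -natr1 in e2; nra.
Qed.

Lemma mean_pressureS_le (beta : \bar R) : (0 <= beta)%E ->
  `|mean_pressure nu beta [set: config N.+1]%SET -
    mean_pressure mu beta [set: config N]%SET| <=
  (1 + 4 * weight beta * kappa) * Num.sqrt N%:R.
Proof.
move=> b0; have w0 := weight_ge0 b0.
pose s0 : config N.+1 := [ffun=> ord0].
pose P x := pressure beta (hamiltonian (curried (x \o corner))) [set: config N]%SET.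
have mP : measurable_fun setT (fun x : field_space R (pairs N) =>
    pressure beta (hamiltonian (curried x)) [set: config N]%SET).
  apply: (measurable_pressure _ (finset.in_setT (restrict s0))) => s.
  exact: measurable_hamiltonian.
have meanE : mean_pressure mu beta [set: config N]%SET = \int[nu]_x P x.
  have /measurable_EFinP mP' := mP.
  exact/esym/(congr1 fine (gaussian_subfield gnu gmu corner_inj mP')).
have iS := integrable_pressure gnu b0 (finset.in_setT s0).
have i1 := integrable_site_error.
have i2 := integrable_addR (finite_measure_integrable_cst nu (ln 2) measurableT)
  (integrable_mulR (weight beta) i1).
have iP : nu.-integrable setT (EFin \o P).
  apply: (le_integrable measurableT _ (g := EFin \o (fun x =>
     `|pressure beta (hamiltonian (curried x)) [set: config N.+1]%SET| +
     (ln 2 + weight beta * site_error x)))).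
  - apply/measurable_EFinP; apply: (measurableT_comp mP).
    by apply: measurable_field => p; exact: measurable_coord.
  - move=> x _; rewrite lee_fin; apply: le_trans (ler_norm _).
    have := pressure_restrict_le x b0; rewrite distrC => h.
    rewrite -lerBlDl; apply: le_trans h.
    exact: lerB_dist.
  - apply: integrable_addR => //; exact: integrable_norm iS.
rewrite meanE -RintegralB//; apply: le_trans (le_normr_Rintegral _ _) _ => //.
  exact: integrableB iS iP.
apply: (@le_trans _ _ (\int[nu]_x (ln 2 + weight beta * site_error x))).
  apply: le_Rintegral => //.
  - by apply: integrable_norm; exact: integrableB iS iP.
  - by move=> x _; exact: pressure_restrict_le.
rewrite RintegralD//; [|exact: finite_measure_integrable_cst|exact: integrable_mulR].
rewrite Rintegral_probability_cst RintegralZl//.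
have := ler_wpM2l w0 expectation_site_error.
have sq1 : 1 <= Num.sqrt N%:R :> R by rewrite -[X in X <= _]sqrtr1 ler_sqrt ?ler1n ?ltr0n.
have : ln 2 <= 1 :> R by have := @le_ln1Dx R 1; rewrite (_ : 1 + 1 = 2)//; apply; lra.
by lra.
Qed.

End OneMoreSite.

(** * Passage to the limit *)

Section EvenSubsequence.
Context {R : realType}.
Implicit Types F G : nat -> R.

Lemma exists_root12 (n : nat) : (0 < n)%N -> exists2 y : R, 1 <= y & y ^+ 12 = n%:R.
Proof.
move=> n0; pose y : R := n%:R `^ 12^-1.
have y12 : y ^+ 12 = n%:R.
  by rewrite /y -powR_mulrn ?powR_ge0// -powRrM mulVf// powRr1.
exists y => //; rewrite -(@ler_pXn2r _ 12)// ?nnegrE ?powR_ge0//.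
by rewrite expr1n y12 ler1n.
Qed.

(** Vanishing increments propagate convergence from the even indices to all of
them; hence [F] and [G] converge together to the same limit, or both diverge, in
which case both [limn] are the default point. *)
Lemma limn_even_eq F G :
  (fun k => F k.*2 - G k) @ \oo --> (0 : R) ->
  (fun n => F n.+1 - F n) @ \oo --> (0 : R) ->
  limn G = limn F.
Proof.
move=> FG dF.
have even_sub (l : R) : F @ \oo --> l -> (fun k => F k.*2) @ \oo --> l.
  move=> Fl; apply: cvg_comp Fl; apply/cvgnyPge => A; near=> k.
  rewrite -addnn; apply: leq_trans (leq_addr _ _); near: k; exact: nbhs_infty_ge.
have even_full (l : R) : (fun k => F k.*2) @ \oo --> l -> F @ \oo --> l.
  move=> Fe; apply/cvgrPdist_le => e e0.
  have e20 : 0 < e / 2 by rewrite divr_gt0.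
  have /cvgrPdist_le/(_ _ e20)[A _ hA] := Fe.
  have /cvgrPdist_le/(_ _ e20)[B _ hB] := dF.
  exists (maxn A.*2 B).+1 => // n /= hn.
  have hA' : `|l - F n./2.*2| <= e / 2 by apply: hA => /=; lia.
  have [on|en] := boolP (odd n); last first.
    by rewrite (_ : n = n./2.*2); [lra|lia].
  have hB' : `|0 - (F n./2.*2.+1 - F n./2.*2)| <= e / 2 by apply: hB => /=; lia.
  rewrite {1}(_ : n = n./2.*2.+1); last by lia.
  move: hA' hB'; set a := F _; set b := F _.
  rewrite !ler_norml => /andP[? ?] /andP[? ?]; apply/andP; split; lra.
have [cF|dvF] := pselect (cvg (F @ \oo)).
  have Gl : G @ \oo --> limn F.
    rewrite (_ : G = (fun k => F k.*2) - (fun k => F k.*2 - G k)).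
      by rewrite -[limn F]subr0; exact: cvgB (even_sub _ cF) FG.
    by apply/funext => k; rewrite !fctE opprB addrCA subrr addr0.
  exact: cvg_lim Gl.
have [cG|dvG] := pselect (cvg (G @ \oo)); last first.
  by rewrite (dvgP dvF) (dvgP dvG).
exfalso; apply: dvF; apply/cvg_ex; exists (limn G); apply: even_full.
rewrite (_ : (fun k => F k.*2) = G + (fun k => F k.*2 - G k)).
  by rewrite -[limn G]addr0; exact: cvgD cG FG.
by apply/funext => k; rewrite !fctE addrCA subrr addr0.
Unshelve. all: by end_near. Qed.

End EvenSubsequence.

Section MainLimit.
Context {R : realType} (d : nat -> measure_display)
  (T : forall N : nat, measurableType (d N)) (P : forall N : nat, probability (T N) R)
  (g : forall N : nat, 'I_N -> 'I_N -> {RV (P N) >-> R}).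
Hypothesis g_iid : forall N : nat, iid_standard_normal (@g N).
Local Notation kappa := (1 + @fourth_moment R).

Let law N := cid2 (iid_gaussian_field (g_iid N)).
Let mu N : probability (field_space R ('I_N * 'I_N)%type) R := s2val (law N).
Let gmu N : gaussian_field (mu N) := s2valP (law N).

Let per_site (beta : \bar R) N (A : {set config N}) : R :=
  N%:R^-1 * mean_pressure (mu N) beta A.

Lemma mean_pressure_law (beta : \bar R) N (A : {set config N}) s0 : s0 \in A ->
  fine (\int[P N]_w (pressure beta (hamiltonian (couplings (@g N) w)) A)%:E)%E =
  mean_pressure (mu N) beta A.
Proof.
move=> s0A; congr fine.
apply: (s2valP' (law N) (fun x => (pressure beta (hamiltonian (curried x)) A)%:E)).
apply/measurable_EFinP; apply: (measurable_pressure _ s0A) => s.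
exact: measurable_hamiltonian.
Qed.

Lemma free_energy_per_site (b : R) N (A : {set config N}) s0 : s0 \in A ->
  free_energy (@g N) b A = per_site b%:E A.
Proof.
by move=> s0A; rewrite /free_energy unlock (mean_pressure_law b%:E s0A).
Qed.

Lemma ground_state_energy_per_site N (A : {set config N}) s0 : s0 \in A ->
  ground_state_energy (@g N) A = per_site +oo%E A.
Proof.
by move=> s0A; rewrite /ground_state_energy unlock (mean_pressure_law +oo%E s0A).
Qed.

Lemma per_site_gap_cvg0 (beta : \bar R) : (0 <= beta)%E ->
  (fun k => per_site beta [set: config k.*2]%SET - per_site beta (@balanced R k.*2))
    @ \oo --> (0 : R).
Proof.
move=> b0; have w0 := weight_ge0 b0.
set K : R := gap_constant (weight beta).
have K0 : 0 < K.
  have m4 := @fourth_moment_ge0 R.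
  have : 0 <= 32 * weight beta * kappa by apply: mulr_ge0; [exact: mulr_ge0|lra].
  have : 0 <= 8 * weight beta ^+ 2 * kappa.
    by apply: mulr_ge0; [apply: mulr_ge0 => //; exact: sqr_ge0|lra].
  by rewrite /K /gap_constant; lra.
apply/cvgrPdist_le => e e0; near=> k.
have k0 : (0 < k)%N by near: k; exact: nbhs_infty_gt.
have kbig : (K / e) ^+ 12 <= k%:R by near: k; exact: nbhs_infty_ger.
have N0 : (0 < k.*2)%N by rewrite double_gt0.
have [y y1 yN] := exists_root12 (R := R) N0.
have y0 : 0 < y by lra.
have Np : 0 < k.*2%:R :> R by rewrite ltr0n.
have [s0 s0B] := exists_near_balanced (R := R) k0 0.
rewrite (near_balanced0 (R := R) k0) in s0B.
have up := mean_pressure_gap_asymptotics (@gmu k.*2) k0 b0 y1 yN.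
have lo : mean_pressure (mu k.*2) beta (balanced (R := R)) <=
    mean_pressure (mu k.*2) beta [set: config k.*2]%SET.
  apply: le_Rintegral => //.
  - exact: (integrable_pressure (@gmu _) b0 s0B).
  - exact: (integrable_pressure (@gmu _) b0 (finset.in_setT s0)).
  - by move=> x _; apply: pressure_sub s0B _ => //; exact: finset.subsetT.
rewrite sub0r normrN /per_site -mulrBr ger0_norm; last first.
  by rewrite mulr_ge0 ?invr_ge0 ?subr_ge0.
rewrite mulrC ler_pdivrMr//.
have Ky : K <= e * y.
  have : (K / e) ^+ 12 <= y ^+ 12.
    by rewrite yN (le_trans kbig)// ler_nat -addnn leq_addr.
  have Ke : K / e \in Num.nneg by rewrite nnegrE ltW// divr_gt0.
  by rewrite ler_pXn2r// ?nnegrE ?(ltW y0)// ler_pdivrMr// mulrC.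
apply: (@le_trans _ _ (K * y ^+ 11)); first by rewrite lerBlDl.
by rewrite -yN [y ^+ 12]exprS [leRHS]mulrA ler_wpM2r// exprn_ge0// ltW.
Unshelve. all: by end_near. Qed.

Lemma per_site_diff_cvg0 (beta : \bar R) : (0 <= beta)%E ->
  (fun N => per_site beta [set: config N.+1]%SET - per_site beta [set: config N]%SET)
    @ \oo --> (0 : R).
Proof.
move=> b0; have w0 := weight_ge0 b0; set w := weight beta in w0.
have m4 := @fourth_moment_ge0 R.
have wk : 0 <= w * kappa by apply: mulr_ge0 => //; lra.
set K : R := 2 + 5 * (w * kappa).
have K0 : 0 < K by rewrite /K; lra.
apply/cvgrPdist_le => e e0; near=> N.
have N0 : (0 < N)%N by near: N; exact: nbhs_infty_gt.
have Nbig : (K / e) ^+ 2 <= N%:R by near: N; exact: nbhs_infty_ger.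
have Np : 0 < N%:R :> R by rewrite ltr0n.
pose s0 : config N := [ffun=> ord0].
have h1 := mean_pressureS_le N0 (@gmu N) (@gmu N.+1) b0.
have h2 := mean_pressure_norm_le (@gmu N) b0 (finset.in_setT s0).
rewrite sub0r normrN /per_site.
move: h1 h2; rewrite -/w; set a := mean_pressure _ _ _; set c := mean_pressure _ _ _.
set q := Num.sqrt N%:R => h1 h2.
have q0 : 0 < q by rewrite sqrtr_gt0.
have qq : N%:R = q ^+ 2 by rewrite sqr_sqrtr// ltW.
have q1 : 1 <= q by rewrite -[X in X <= _]sqrtr1 ler_sqrt ?ler1n.
have Kq : K <= e * q.
  have Ke : K / e \in Num.nneg by rewrite nnegrE ltW// divr_gt0.
  move: Nbig; rewrite qq.
  by rewrite ler_pXn2r// ?nnegrE ?(ltW q0)// ler_pdivrMr// mulrC.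
have -> : N.+1%:R^-1 * a - N%:R^-1 * c = N.+1%:R^-1 * (a - c) - N.+1%:R^-1 * N%:R^-1 * c.
  by rewrite -natr1; field; rewrite natr1 !pnatr_eq0 /= -lt0n N0.
apply: le_trans (ler_normB _ _) _; rewrite !normrM !normfV !normr_nat.
have iN : N.+1%:R^-1 <= N%:R^-1 :> R by rewrite lef_pV2 ?posrE ?ltr0n// ler_nat.
have iN0 : 0 <= N%:R^-1 :> R by rewrite invr_ge0.
have iS0 : 0 <= N.+1%:R^-1 :> R by rewrite invr_ge0.
have b1 : N.+1%:R^-1 * `|a - c| <= N%:R^-1 * ((1 + 4 * w * kappa) * q) by exact: ler_pM.
have b2 : N.+1%:R^-1 * N%:R^-1 * `|c| <=
    N%:R^-1 * N%:R^-1 * (N%:R + w * (q^-1 * (N%:R ^+ 2 * kappa))).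
  by apply: ler_pM => //; apply: ler_wpM2r.
apply: le_trans (lerD b1 b2) _; rewrite qq.
have -> : (q ^+ 2)^-1 * ((1 + 4 * w * kappa) * q) +
   (q ^+ 2)^-1 * (q ^+ 2)^-1 * (q ^+ 2 + w * (q^-1 * ((q ^+ 2) ^+ 2 * kappa))) =
   (1 + 5 * (w * kappa) + q^-1) / q by field; rewrite gt_eqF.
rewrite ler_pdivrMr//; apply: le_trans Kq; rewrite /K.
have : q^-1 <= 1 by rewrite invf_le1.
lra.
Unshelve. all: by end_near. Qed.

Lemma color_symmetry (beta : \bar R) : (0 <= beta)%E -> preserves_color_symmetry (@g) beta.
Proof.
move=> b0; have lims := limn_even_eq (per_site_gap_cvg0 b0) (per_site_diff_cvg0 b0).
have bal k (F : R) : (forall s, s \in @balanced R k.*2 ->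
    k.*2%:R^-1 * F = per_site beta (@balanced R k.*2)) ->
    k.*2%:R^-1 * F = per_site beta (@balanced R k.*2).
  (* At size 0 there is no balanced configuration, but both sides vanish. *)
  case: k => [|k] hF; first by rewrite /per_site invr0 !mul0r.
  have [s sB] := exists_near_balanced (R := R) (ltn0Sn k) 0.
  by apply: (hF s); rewrite -(near_balanced0 (R := R) (ltn0Sn k)).
case: beta b0 lims bal => [b| |] //= _ lims bal; move: lims.
  rewrite (_ : (fun k => per_site b%:E (@balanced R k.*2)) =
    (fun k => free_energy (@g k.*2) b (@balanced R k.*2))); last first.
    by apply/funext => k; apply/esym/bal => s; exact: free_energy_per_site.
  rewrite (_ : (fun n => per_site b%:E [set: config n]%SET) =
    (fun n => free_energy (@g n) b [set: config n]%SET))//.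
  apply/funext => n; apply/esym/(free_energy_per_site _ (s0 := [ffun=> ord0])).
  exact: finset.in_setT.
rewrite (_ : (fun k => per_site +oo%E (@balanced R k.*2)) =
  (fun k => ground_state_energy (@g k.*2) (@balanced R k.*2))); last first.
  by apply/funext => k; apply/esym/bal => s; exact: ground_state_energy_per_site.
rewrite (_ : (fun n => per_site +oo%E [set: config n]%SET) =
  (fun n => ground_state_energy (@g n) [set: config n]%SET))//.
apply/funext => n; apply/esym/(ground_state_energy_per_site (s0 := [ffun=> ord0])).
exact: finset.in_setT.
Qed.

End MainLimit.

Local Close Scope classical_set_scope.
Unset Implicit Arguments.

Theorem proposition1p5 (R : realType) (d : nat -> measure_display)
    (T : forall N : nat, measurableType (d N))
    (P : forall N : nat, probability (T N) R)
    (g : forall N : nat, 'I_N -> 'I_N -> {RV (P N) >-> R})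
    (g_iid : forall N : nat, iid_standard_normal (g N)) :
  (forall (beta : \bar R) (eps : R) (N : nat),
      (0 <= beta)%E -> 0 < eps -> (1 <= N)%N ->
      (mean_gibbs (g N) beta (unbalanced eps)
        <= (2 * expR (- (eps ^+ 2 * N%:R)))%:E)%E) /\
  (forall beta : \bar R, (0 <= beta)%E -> preserves_color_symmetry g beta).
Proof.
split=> [beta eps N beta0 eps0 N0|beta beta0].
  exact: mean_gibbs_unbalanced.
exact: color_symmetry.
Qed.
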